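(* Let $L\in\mathbb Z_{\ge1}$, $\delta>0$, $C>0$. For all integers $N\ge1$ and all $z\in\mathbb C$ with $\mathrm{Re}(z)\le-\delta$ and $|z|\le C$, $$\frac{1}{(e^{z/N})_N}=\Big(\frac{-z}{2\pi N(1-e^{z})}\Big)^{1/2}\exp\Big(N\,p(z)+\sum_{\ell=1}^{L-1}\frac{f_\ell(z)}{N^\ell}+O(N^{-L})\Big),$$ with the principal square root and an implied constant depending only on $L,\delta,C$.
   Context: $(q)_N:=(1-q)(1-q^2)\cdots(1-q^N)$. Polylogarithms: $\mathrm{Li}_s(w)=\sum_{n\ge1}w^n/n^s$ for $|w|<1$ (and $|w|\le 1$ when $s=2$). $p(z):=\dfrac{\mathrm{Li}_2(e^{z})-\mathrm{Li}_2(1)}{z}$ (with $\mathrm{Li}_2(1)=\pi^2/6$), and for $\ell\ge1$, $f_\ell(z):=\delta_{1,\ell}\dfrac{z}{24}+\dfrac{B_{\ell+1}}{(\ell+1)!}z^{\ell}\,\mathrm{Li}_{1-\ell}(e^{z})$, where $B_n$ are the Bernoulli numbers ($z/(e^z-1)=\sum B_nz^n/n!$) and $\delta_{i,j}$ is the Kronecker delta. *)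

(* Defs.v *)
From Stdlib Require Import Reals Lra ZArith List ClassicalEpsilon.
Open Scope R_scope.

Definition CC : Type := (R * R)%type.
Definition Cre (z : CC) : R := fst z.
Definition Cim (z : CC) : R := snd z.
Definition RtoC (x : R) : CC := (x, 0).
Definition Czero : CC := (0, 0).
Definition Cone : CC := (1, 0).
Definition Cadd (z w : CC) : CC := (fst z + fst w, snd z + snd w).
Definition Copp (z : CC) : CC := (- fst z, - snd z).
Definition Csub (z w : CC) : CC := Cadd z (Copp w).
Definition Cmul (z w : CC) : CC :=
  (fst z * fst w - snd z * snd w, fst z * snd w + snd z * fst w).
Definition Cnorm (z : CC) : R := sqrt (fst z * fst z + snd z * snd z).
Definition Cinv (z : CC) : CC :=
  let d := fst z * fst z + snd z * snd z in (fst z / d, - snd z / d).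
Definition Cdiv (z w : CC) : CC := Cmul z (Cinv w).
Definition Cscal (r : R) (z : CC) : CC := (r * fst z, r * snd z).
Fixpoint Cpow (z : CC) (n : nat) : CC :=
  match n with O => Cone | S m => Cmul z (Cpow z m) end.
Definition Cexp (z : CC) : CC := (exp (fst z) * cos (snd z), exp (fst z) * sin (snd z)).

(** Principal square root (branch cut on the negative real axis,
    Re(sqrt w) >= 0, and sqrt of a negative real is i*sqrt|w|). *)
Definition Csqrt (w : CC) : CC :=
  let a := fst w in let b := snd w in
  let r := Cnorm w in
  (sqrt ((r + a) / 2),
   (if Rlt_dec b 0 then -1 else 1) * sqrt ((r - a) / 2)).

Fixpoint Csum (n : nat) (f : nat -> CC) : CC :=
  match n with O => Czero | S m => Cadd (Csum m f) (f m) end.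
Fixpoint Cprod (n : nat) (f : nat -> CC) : CC :=
  match n with O => Cone | S m => Cmul (Cprod m f) (f m) end.

(** Sum of a convergent complex series sum_{n>=0} a n
    (meaningful when the series converges; limits are unique). *)
Definition Cseries_converges_to (a : nat -> CC) (l : CC) : Prop :=
  Un_cv (fun n => fst (Csum (S n) a)) (fst l) /\
  Un_cv (fun n => snd (Csum (S n) a)) (snd l).
Definition Cseries (a : nat -> CC) : CC :=
  epsilon (inhabits Czero) (fun l => Cseries_converges_to a l).

Definition qpoch (q : CC) (N : nat) : CC :=
  Cprod N (fun k => Csub Cone (Cpow q (S k))).

Definition Li (s : Z) (w : CC) : CC :=
  Cseries (fun n => Cscal (powerRZ (INR (S n)) (- s)) (Cpow w (S n))).

Definition Li2_one : R := PI ^ 2 / 6.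

(** Bernoulli numbers, convention z/(e^z-1) = sum B_n z^n/n! (so B_1 = -1/2):
    B_0 = 1, B_n = -1/(n+1) * sum_{k=0}^{n-1} binom(n+1,k) B_k. *)
Fixpoint bern_list (n : nat) : list R :=
  match n with
  | O => 1 :: nil
  | S m =>
      let l := bern_list m in
      l ++ ((- / INR (S n)) *
             fold_right Rplus 0
               (map (fun k => Binomial.C (S n) k * nth k l 0) (seq 0 n))) :: nil
  end.
Definition bernoulli (n : nat) : R := nth n (bern_list n) 0.

Definition pfun (z : CC) : CC :=
  Cdiv (Csub (Li 2 (Cexp z)) (RtoC Li2_one)) z.

Definition ffun (l : nat) (z : CC) : CC :=
  Cadd (if Nat.eqb l 1 then Cscal (/ 24) z else Czero)
       (Cscal (bernoulli (S l) / INR (fact (S l)))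
              (Cmul (Cpow z l) (Li (1 - Z.of_nat l) (Cexp z)))).

(* Main.v *)
(** Put [t_k = k/N] and write [1 - exp (t z) = - t z exp (g t)], where [g] is smooth on
    [[0, 1]] and vanishes at [0]. Then [(q)_N = exp (sum_k g t_k) * (- z)^N * N! / N^N].
    The sum of [g] is expanded by Euler-Maclaurin, uniformly in [z], and [N!] by Stirling's
    series. For [t > 0] the derivatives of [g] are polylogarithms minus derivatives of [ln t],
    and the latter cancel against Stirling's series. At [0] only [g' 0 = z/2] survives,
    because [B_j = 0] for odd [j >= 3] and [g' - z/2] is odd; it gives the term [z/24] of [f_1].
    The integral of [g] is [- p z + 1 + kappa] with [exp kappa = - 1/z], the value
    [Li_2 1 = pi^2/6] entering as the limit at [t -> 0]. *)
Require Import Defs.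
From Stdlib Require Import Reals ZArith.
From Stdlib Require Import Lra Lia List FunctionalExtensionality ClassicalEpsilon.
From Coquelicot Require Import Rbar Hierarchy Derive RInt RInt_analysis Series PSeries
  Lim_seq Continuity ElemFct AutoDerive Rcomplements Lub.
Open Scope R_scope.

(** * Euler-Maclaurin summation *)

(** All analysis takes place in the real variable [t]: complex functions are pairs of real
    functions, and neither contour integrals nor a complex logarithm occur. The factor [- t z] is
    split off because [ln (1 - exp (t z))] is singular at [t = 0], whereas Euler-Maclaurin needs
    bounded derivatives up to the end point. Uniformity in [z] rests on one estimate, a lower bound
    for [(exp (t z) - 1) / (t z)] when [Re z <= - delta] and [|z| <= C]; every derivative of [g] is
    a polynomial in [z], in bounded entire functions and in the inverse of that quotient. No branch
    of [ln (- 1/z)] is chosen: [kappa] occurs [N] times in the integral term and [N] times in the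
    factors [- z], and cancels. The only branch question is the square root; it comes from the
    boundary term [g 1 / 2] and is settled by bounding the imaginary part of [g 1] by [PI].
    Euler-Maclaurin itself is the formal identity [B(D) (exp D - 1) = D], with
    [B(x) = x / (exp x - 1)], combined with Taylor's formula. Its remainder is crude, so expansions
    are pushed one term too far and the surplus term is moved into the error. *)

Fixpoint rsum (n : nat) (f : nat -> R) : R :=
  match n with O => 0 | S m => rsum m f + f m end.

Lemma rsum_S n f : rsum (S n) f = rsum n f + f n.
Proof. reflexivity. Qed.

Lemma rsum_ext n f g : (forall k, (k < n)%nat -> f k = g k) -> rsum n f = rsum n g.
Proof.
  induction n as [|n IH]; intros Hfg; simpl; [reflexivity|].
  rewrite IH, Hfg; auto with arith.
Qed.

Lemma rsum_plus n f g : rsum n (fun k => f k + g k) = rsum n f + rsum n g.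
Proof. induction n as [|n IH]; simpl; [ring|]. rewrite IH; ring. Qed.

Lemma rsum_minus n f g : rsum n (fun k => f k - g k) = rsum n f - rsum n g.
Proof. induction n as [|n IH]; simpl; [ring|]. rewrite IH; ring. Qed.

Lemma rsum_scal n c f : rsum n (fun k => c * f k) = c * rsum n f.
Proof. induction n as [|n IH]; simpl; [ring|]. rewrite IH; ring. Qed.

Lemma rsum_le n f g : (forall k, (k < n)%nat -> f k <= g k) -> rsum n f <= rsum n g.
Proof.
  induction n as [|n IH]; intros Hfg; simpl; [lra|].
  apply Rplus_le_compat; auto with arith.
Qed.

Lemma rsum_abs n f : Rabs (rsum n f) <= rsum n (fun k => Rabs (f k)).
Proof.
  induction n as [|n IH]; simpl.
  - rewrite Rabs_R0; lra.
  - eapply Rle_trans; [apply Rabs_triang|lra].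
Qed.

Lemma rsum_const n c : rsum n (fun _ => c) = INR n * c.
Proof. induction n as [|n IH]; [simpl; ring|]. rewrite S_INR; simpl; rewrite IH; ring. Qed.

Lemma rsum_nonneg n f : (forall k, (k < n)%nat -> 0 <= f k) -> 0 <= rsum n f.
Proof.
  intros Hf. replace 0 with (rsum n (fun _ => 0)) by (rewrite rsum_const; ring).
  now apply rsum_le.
Qed.

Lemma rsum_shift n f : rsum (S n) f = f O + rsum n (fun k => f (S k)).
Proof.
  induction n as [|n IH]; [simpl; ring|].
  change (rsum (S (S n)) f) with (rsum (S n) f + f (S n)). rewrite IH; simpl; ring.
Qed.

Lemma rsum_telescope n f : rsum n (fun k => f (S k) - f k) = f n - f O.
Proof. induction n as [|n IH]; simpl; [ring|]. rewrite IH; ring. Qed.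

(** * Bernoulli numbers divided by factorials *)

Lemma bern_list_length n : length (bern_list n) = S n.
Proof.
  induction n as [|n IH]; [reflexivity|].
  cbn [bern_list]. rewrite length_app, IH. simpl; lia.
Qed.

Lemma bern_list_nth n k : (k <= n)%nat -> nth k (bern_list n) 0 = bernoulli k.
Proof.
  induction n as [|n IH]; intros Hk.
  - now replace k with O by lia.
  - destruct (Nat.eq_dec k (S n)) as [->|Hne]; [reflexivity|].
    rewrite <- IH by lia. cbn [bern_list].
    rewrite app_nth1; [reflexivity|rewrite bern_list_length; lia].
Qed.

Lemma fold_right_rsum f n : fold_right Rplus 0 (map f (seq 0 n)) = rsum n f.
Proof.
  revert f. induction n as [|n IH]; intros f; [reflexivity|].
  rewrite rsum_shift, <- IH. cbn [seq map fold_right].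
  now rewrite <- seq_shift, map_map.
Qed.

Lemma bernoulli_rec n :
  bernoulli (S n) = - / INR (S (S n)) *
    rsum (S n) (fun k => Binomial.C (S (S n)) k * bernoulli k).
Proof.
  unfold bernoulli at 1. cbn [bern_list].
  rewrite app_nth2; rewrite bern_list_length; [|lia].
  replace (S n - S n)%nat with O by lia. cbn [nth].
  rewrite fold_right_rsum. f_equal. apply rsum_ext; intros k Hk.
  now rewrite bern_list_nth by lia.
Qed.

(** The coefficients of the power series [B(x) = x / (exp x - 1)]: both the weights of
    Euler-Maclaurin and the rational factors in [ffun]. *)
Definition beta (n : nat) : R := bernoulli n / INR (fact n).

Lemma beta_0 : beta 0 = 1.
Proof. unfold beta, bernoulli; simpl; field. Qed.

(** Coefficient of [x^(n+2)] in [B(x) (exp x - 1) = x]; it is the recursion of [bernoulli] divided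
    by [(n+2)!]. *)
Lemma beta_conv n :
  rsum (S (S n)) (fun k => beta k / INR (fact (S (S n) - k))) = 0.
Proof.
  change (rsum (S (S n)) (fun k => beta k / INR (fact (S (S n) - k))))
    with (rsum (S n) (fun k => beta k / INR (fact (S (S n) - k)))
          + beta (S n) / INR (fact (S (S n) - S n))).
  replace (S (S n) - S n)%nat with 1%nat by lia.
  unfold beta at 2. rewrite bernoulli_rec.
  rewrite (rsum_ext (S n) (fun k => Binomial.C (S (S n)) k * bernoulli k)
    (fun k => INR (fact (S (S n))) * (beta k / INR (fact (S (S n) - k))))).
  - rewrite rsum_scal. change (INR (fact 1)) with 1.
    rewrite (fact_simpl (S n)), mult_INR.
    field. split; [apply not_0_INR; lia|apply INR_fact_neq_0].
  - intros k Hk. unfold Binomial.C, beta.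
    field. split; apply INR_fact_neq_0.
Qed.

Lemma beta_1 : beta 1 = - / 2.
Proof.
  generalize (beta_conv 0). cbn [rsum]. rewrite beta_0. simpl. lra.
Qed.

Lemma beta_2 : beta 2 = / 12.
Proof.
  generalize (beta_conv 1). cbn [rsum]. rewrite beta_0, beta_1. simpl. lra.
Qed.

(** * Taylor's formula and the Euler-Maclaurin step *)

Definition taylor (c : nat -> R) (n : nat) (s : R) : R :=
  rsum n (fun i => s ^ i / INR (fact i) * c i).

Lemma is_derive_taylor c n s :
  is_derive (taylor c (S n)) s (taylor (fun i => c (S i)) n s).
Proof.
  induction n as [|n IH].
  - apply (is_derive_ext (fun _ => c O)).
    + intros t. unfold taylor; simpl; field.
    + unfold taylor; simpl. apply @is_derive_const.
  - apply (is_derive_ext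
      (fun s => taylor c (S n) s + s ^ S n / INR (fact (S n)) * c (S n))).
    { reflexivity. }
    change (taylor (fun i => c (S i)) (S n) s) with
      (taylor (fun i => c (S i)) n s + s ^ n / INR (fact n) * c (S n)).
    apply @is_derive_plus; [exact IH|].
    rewrite fact_simpl, mult_INR.
    generalize (INR_fact_neq_0 n) (not_0_INR (S n) ltac:(lia)).
    generalize (INR (fact n)). intros q Hq Hn.
    auto_derive; [exact I|]. change (pred (S n)) with n. cbn [INR] in *. field. now split.
Qed.

Lemma MVT_bound (f df : R -> R) (a h M : R) :
  0 <= h -> (forall t, a <= t <= a + h -> is_derive f t (df t)) ->
  (forall t, a <= t <= a + h -> Rabs (df t) <= M) ->
  Rabs (f (a + h) - f a) <= M * h.
Proof.
  intros Hh Hd Hb.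
  destruct (MVT_gen f a (a + h) df) as [c [Hc E]];
    try rewrite Rmin_left in * by lra; try rewrite Rmax_right in * by lra.
  - intros x Hx. apply Hd; lra.
  - intros x Hx. apply derivable_continuous_pt.
    exists (df x). apply is_derive_Reals, Hd; lra.
  - rewrite E, Rabs_mult. replace (a + h - a) with h by ring.
    rewrite (Rabs_pos_eq h) by lra.
    apply Rmult_le_compat_r; [lra|]. now apply Hb.
Qed.

(** Induction through the mean value theorem: the derivative of the remainder is the remainder of
    [H 1], one order lower. Bounding it instead of integrating it loses the factorial, which only
    affects constants. *)
Lemma taylor_bound n : forall (H : nat -> R -> R) (a h M : R),
  0 <= h ->
  (forall k t, a <= t <= a + h -> is_derive (H k) t (H (S k) t)) ->
  (forall t, a <= t <= a + h -> Rabs (H (S n) t) <= M) ->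
  Rabs (H O (a + h) - taylor (fun i => H i a) (S n) h) <= M * h ^ S n.
Proof.
  induction n as [|n IH]; intros H a h M Hh Hd HM.
  - replace (taylor (fun i => H i a) 1 h) with (H O a) by (unfold taylor; simpl; field).
    replace (h ^ 1) with h by ring.
    apply MVT_bound with (df := H 1%nat); [assumption|apply Hd|assumption].
  - set (phi := fun s => H O (a + s) - taylor (fun i => H i a) (S (S n)) s).
    set (dphi := fun s => H 1%nat (a + s) - taylor (fun i => H (S i) a) (S n) s).
    assert (HM0 : 0 <= M).
    { eapply Rle_trans; [apply Rabs_pos|apply (HM a); lra]. }
    assert (P0 : phi 0 = 0).
    { unfold phi, taylor. rewrite rsum_shift.
      rewrite (rsum_ext _ _ (fun _ => 0)), rsum_const.
      - rewrite Rplus_0_r. simpl; field.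
      - intros k _. rewrite pow_i by lia. unfold Rdiv; ring. }
    replace (H O (a + h) - _) with (phi (0 + h) - phi 0)
      by (rewrite P0, Rplus_0_l; unfold phi; ring).
    replace (M * h ^ S (S n)) with (M * h ^ S n * h) by (simpl; ring).
    apply MVT_bound with (df := dphi); [assumption| |].
    + intros s Hs. unfold phi, dphi.
      apply @is_derive_minus; [|apply is_derive_taylor].
      evar_last.
      * apply @is_derive_comp; [apply Hd; lra|]. auto_derive; [exact I|reflexivity].
      * unfold scal; simpl; unfold mult; simpl; ring.
    + intros s Hs. unfold dphi.
      eapply Rle_trans.
      * apply (IH (fun k => H (S k)) a s M); [lra| |].
        -- intros k t Ht. apply Hd; lra.
        -- intros t Ht. apply HM; lra.
      * apply Rmult_le_compat_l; [assumption|]. apply pow_incr; lra.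
Qed.

(** The truncated symbol [h D / (exp (h D) - 1)] applied to an antiderivative
    [H 0] of [H 1]: its increment over a step [h] is [h * H 1] up to [O(h^(J+1))]. *)
Definition emq (J : nat) (h : R) (H : nat -> R -> R) (a : R) : R :=
  rsum (S J) (fun j => beta j * h ^ j * H j a).

(** The identity [B(D) (exp D - 1) = D] cut off after degree [J + 1], with [y n] standing for [h^n]
    times the [n]-th derivative at a point. *)
Lemma beta_taylor_cancel y J :
  rsum (S (S J)) (fun j => beta j *
     rsum (S (S J - j)) (fun i => y (i + j)%nat / INR (fact i)))
  - rsum (S (S J)) (fun j => beta j * y j) = y 1%nat.
Proof.
  (* [T J] is the part of [B(D) exp D] of degree at most [J]. One more degree adds a convolution
     that [beta_conv] kills, except for its last term. *)
  set (T := fun J => rsum (S J) (fun j => beta j *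
     rsum (S (J - j)) (fun i => y (i + j)%nat / INR (fact i)))).
  assert (TS : forall J, T (S J) = T J
     + y (S J) * (rsum (S J) (fun k => beta k / INR (fact (S J - k)))) + beta (S J) * y (S J)).
  { intros n. unfold T at 1. rewrite rsum_S.
    rewrite (rsum_ext (S n) _ (fun j => beta j * rsum (S (n - j)) (fun i => y (i + j)%nat / INR (fact i))
      + y (S n) * (beta j / INR (fact (S n - j))))).
    - rewrite rsum_plus, rsum_scal. fold (T n). rewrite Nat.sub_diag.
      rewrite (rsum_S 0). change (INR (fact 0)) with 1. simpl (0 + S n)%nat. cbn [rsum]. field. apply INR_fact_neq_0.
    - intros j Hj. replace (S n - j)%nat with (S (n - j)) by lia.
      rewrite rsum_S. replace (S (n - j) + j)%nat with (S n) by lia. field. apply INR_fact_neq_0. }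
  fold (T (S J)).
  induction J as [|J IH].
  - unfold T. cbn. rewrite beta_0, beta_1. field.
  - rewrite TS, beta_conv.
    change (rsum (S (S (S J))) (fun j => beta j * y j)) with
      (rsum (S (S J)) (fun j => beta j * y j) + beta (S (S J)) * y (S (S J))).
    lra.
Qed.

(** Each [H j (a + h)] is expanded up to total degree [J + 1], so that all remainders involve the
    same derivative and the same power of [h]; the Taylor polynomials cancel by
    [beta_taylor_cancel]. *)
Lemma euler_maclaurin_step J (H : nat -> R -> R) (a h M : R) :
  0 <= h ->
  (forall k t, a <= t <= a + h -> is_derive (H k) t (H (S k) t)) ->
  (forall t, a <= t <= a + h -> Rabs (H (S (S J)) t) <= M) ->
  Rabs (emq (S J) h H (a + h) - emq (S J) h H a - h * H 1%nat a)
  <= rsum (S (S J)) (fun j => Rabs (beta j)) * M * h ^ S (S J).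
Proof.
  intros Hh Hd HM.
  assert (HM0 : 0 <= M).
  { eapply Rle_trans; [apply Rabs_pos|apply (HM a); lra]. }
  generalize (beta_taylor_cancel (fun n => h ^ n * H n a) J). intros E.
  cbn beta in E. rewrite pow_1 in E.
  rewrite <- E. unfold emq.
  rewrite (rsum_ext _ (fun j => beta j * h ^ j * H j a) (fun j => beta j * (h ^ j * H j a)))
    by (intros; ring).
  match goal with |- Rabs (?A - ?B - (?C - ?B)) <= _ => replace (A - B - (C - B)) with (A - C) by ring end.
  rewrite <- rsum_minus.
  eapply Rle_trans; [apply rsum_abs|].
  rewrite (Rmult_comm _ M), Rmult_assoc, (Rmult_comm _ (h ^ _)), <- Rmult_assoc, <- rsum_scal.
  apply rsum_le; intros j Hj.
  replace (beta j * h ^ j * H j (a + h) - _) with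
    (h ^ j * beta j * (H j (a + h) - taylor (fun i => H (i + j)%nat a) (S (S J - j)) h)).
  - rewrite !Rabs_mult. rewrite (Rabs_pos_eq (h ^ j)) by now apply pow_le.
    apply Rle_trans with (h ^ j * Rabs (beta j) * (M * h ^ S (S J - j))).
    + apply Rmult_le_compat_l.
      { apply Rmult_le_pos; [now apply pow_le|apply Rabs_pos]. }
      apply (taylor_bound _ (fun i => H (i + j)%nat)); [assumption| |].
      * intros k t Ht. now apply Hd.
      * intros t Ht. replace (S (S J - j) + j)%nat with (S (S J)) by lia. now apply HM.
    + right. replace (S (S J)) with (j + S (S J - j))%nat by lia.
      rewrite pow_add. replace (j + S (S J - j) - 1 - j)%nat with (S J - j)%nat by lia. ring.
  - unfold taylor. rewrite Rmult_minus_distr_l. f_equal; [ring|].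
    rewrite (Rmult_comm (h ^ j)), Rmult_assoc, <- rsum_scal. f_equal.
    apply rsum_ext; intros i Hi. rewrite pow_add. field. apply INR_fact_neq_0.
Qed.

Lemma euler_maclaurin_sum J (H : nat -> R -> R) (h M : R) n :
  0 <= h ->
  (forall k t, 0 <= t <= INR n * h -> is_derive (H k) t (H (S k) t)) ->
  (forall t, 0 <= t <= INR n * h -> Rabs (H (S (S J)) t) <= M) ->
  Rabs (emq (S J) h H (INR n * h) - emq (S J) h H 0
        - h * rsum n (fun k => H 1%nat (INR k * h)))
  <= INR n * (rsum (S (S J)) (fun j => Rabs (beta j)) * M * h ^ S (S J)).
Proof.
  intros Hh Hd HM.
  generalize (rsum_telescope n (fun k => emq (S J) h H (INR k * h))). intros T. cbn beta in T.
  simpl (INR 0) in T. rewrite Rmult_0_l in T. rewrite <- T, <- rsum_scal, <- rsum_minus, <- rsum_const.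
  eapply Rle_trans; [apply rsum_abs|]. apply rsum_le; intros k Hk.
  assert (Hk' : INR k + 1 <= INR n) by (rewrite <- S_INR; apply le_INR; lia).
  assert (0 <= INR k) by apply pos_INR.
  assert (Hsub : forall t, INR k * h <= t <= INR k * h + h -> 0 <= t <= INR n * h) by (intros; nra).
  rewrite S_INR. replace ((INR k + 1) * h) with (INR k * h + h) by ring.
  apply euler_maclaurin_step; [assumption| |].
  - intros i t Ht. apply Hd, Hsub, Ht.
  - intros t Ht. apply HM, Hsub, Ht.
Qed.

(** Truncated form of [B(x) - B(- x) = - x]. The Euler-Maclaurin step applied to [exp t] and to
    [exp (- t)] gives [B(x) (exp x - 1) = x] and its reflection up to [O(x^(J+2))]. The first plus
    [exp x] times the second is the claim multiplied by [exp x - 1], and dividing by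
    [exp x - 1 >= x] costs one power of [x]. *)
Lemma beta_odd_bound J :
  exists K, forall x, 0 < x <= 1 ->
    Rabs (x + rsum (S (S J)) (fun j => beta j * (x ^ j - (- x) ^ j))) <= K * x ^ S J.
Proof.
  set (c := rsum (S (S J)) (fun j => Rabs (beta j))).
  exists (c * exp 1 + c * exp 1). intros x Hx.
  assert (c0 : 0 <= c) by (apply rsum_nonneg; intros; apply Rabs_pos).
  assert (P : Rabs (emq (S J) x (fun _ => exp) (0 + x) - emq (S J) x (fun _ => exp) 0 - x * exp 0)
     <= c * exp 1 * x ^ S (S J)).
  { apply (euler_maclaurin_step J (fun _ => exp)); [lra| |].
    - intros _ t _. apply is_derive_exp.
    - intros t Ht. rewrite Rabs_pos_eq by (left; apply exp_pos).
      destruct (Req_dec t 1) as [->|]; [lra|]. left; apply exp_increasing; lra. }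
  set (G := fun (n : nat) t => (-1) ^ n * exp (- t)).
  assert (Q : Rabs (emq (S J) x G (0 + x) - emq (S J) x G 0 - x * G 1%nat 0)
     <= c * 1 * x ^ S (S J)).
  { apply (euler_maclaurin_step J G); [lra| |].
    - intros k t _. unfold G. auto_derive; [exact I|]. simpl; ring.
    - intros t Ht. unfold G. rewrite Rabs_mult, pow_1_abs, Rmult_1_l.
      rewrite Rabs_pos_eq by (left; apply exp_pos). rewrite <- exp_0.
      destruct (Req_dec t 0) as [->|]; [rewrite Ropp_0; lra|]. left; apply exp_increasing; lra. }
  set (b := rsum (S (S J)) (fun j => beta j * x ^ j)).
  set (b' := rsum (S (S J)) (fun j => beta j * (- x) ^ j)).
  assert (EP : forall t, emq (S J) x (fun _ => exp) t = b * exp t).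
  { intros t. unfold emq, b. rewrite Rmult_comm, <- rsum_scal. apply rsum_ext; intros; ring. }
  assert (EQ : forall t, emq (S J) x G t = b' * exp (- t)).
  { intros t. unfold emq, b', G. rewrite Rmult_comm, <- rsum_scal. apply rsum_ext; intros k _.
    replace (- x) with (-1 * x) by ring. rewrite Rpow_mult_distr. ring. }
  rewrite !EP in P. rewrite !EQ in Q. unfold G in Q.
  rewrite Rplus_0_l, Ropp_0, exp_0 in *.
  rewrite (rsum_ext _ _ (fun j => beta j * x ^ j - beta j * (- x) ^ j)) by (intros; ring).
  rewrite rsum_minus. fold b b'.
  assert (ex : x <= exp x - 1) by (generalize (exp_ineq1 x); lra).
  assert (ee : exp x * exp (- x) = 1) by (rewrite <- exp_plus, Rplus_opp_r; apply exp_0).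
  assert (e1 : exp x <= exp 1).
  { destruct (Req_dec x 1) as [->|]; [lra|]. left; apply exp_increasing; lra. }
  assert (p0 : 0 < x ^ S J) by (apply pow_lt; lra).
  apply Rmult_le_reg_l with (exp x - 1); [lra|].
  rewrite <- (Rabs_pos_eq (exp x - 1)) at 1 by lra. rewrite <- Rabs_mult.
  replace ((exp x - 1) * (x + (b - b'))) with
    ((b * exp x - b * 1 - x * 1) + exp x * (b' * exp (- x) - b' * 1 - x * ((-1) ^ 1 * 1))).
  - eapply Rle_trans; [apply Rabs_triang|].
    rewrite Rabs_mult, (Rabs_pos_eq (exp x)) by (left; apply exp_pos).
    apply Rle_trans with (c * exp 1 * x ^ S (S J) + exp 1 * (c * 1 * x ^ S (S J))).
    + apply Rplus_le_compat; [exact P|].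
      apply Rmult_le_compat; [left; apply exp_pos|apply Rabs_pos|exact e1|exact Q].
    + replace (c * exp 1 * x ^ S (S J) + exp 1 * (c * 1 * x ^ S (S J)))
        with (x * ((c * exp 1 + c * exp 1) * x ^ S J)) by (simpl; ring).
      apply Rmult_le_compat_r; [|exact ex].
      generalize (exp_pos 1). intros. apply Rmult_le_pos; [|lra]. nra.
  - replace (exp x * (b' * exp (- x) - b' * 1 - x * ((-1) ^ 1 * 1)))
      with (b' * (exp x * exp (- x)) - b' * exp x + x * exp x) by ring.
    rewrite ee. ring.
Qed.

(** Strong induction: in [beta_odd_bound] even terms cancel, the term of index 1 cancels [x], and
    smaller odd ones vanish. What is left, [2 |beta n| x^n <= K x^(n+1)], fails for small [x] unless
    [beta n = 0]. *)
Lemma beta_odd n : Nat.odd n = true -> (3 <= n)%nat -> beta n = 0.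
Proof.
  induction n as [n IH] using (well_founded_induction lt_wf). intros Ho Hn.
  destruct (beta_odd_bound n) as [K HK].
  assert (on : forall x, (- x) ^ n = - x ^ n).
  { intros x. replace (- x) with (-1 * x) by ring. rewrite Rpow_mult_distr.
    apply Nat.odd_spec in Ho. destruct Ho as [m ->].
    rewrite Nat.add_1_r, pow_1_odd. ring. }
  assert (E : forall x, x + rsum (S (S n)) (fun j => beta j * (x ^ j - (- x) ^ j)) = 2 * beta n * x ^ n).
  { intros x. cbn [rsum]. rewrite on.
    assert (en : (- x) ^ S n = x ^ S n) by (simpl; rewrite on; ring).
    rewrite en, (rsum_ext n _ (fun j => if Nat.eqb j 1 then - x else 0)).
    - assert (Z : forall m, (2 <= m)%nat -> rsum m (fun j => if Nat.eqb j 1 then - x else 0) = - x).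
      { induction m as [|m IHm]; intros Hm; [lia|].
        destruct (Nat.eq_dec m 1) as [->|]; [simpl; ring|].
        cbn [rsum]. rewrite IHm by lia.
        destruct (Nat.eqb_spec m 1); [lia|ring]. }
      rewrite Z by lia. ring.
    - intros j Hj. destruct (Nat.eqb_spec j 1) as [->|Hj1].
      + rewrite beta_1. simpl; field.
      + destruct (Nat.odd j) eqn:Oj.
        * rewrite IH; [ring|lia|assumption|].
          destruct j as [|[|[|j]]]; try discriminate; lia.
        * assert (Ej : Nat.even j = true) by (rewrite <- Nat.negb_odd, Oj; reflexivity).
          apply Nat.even_spec in Ej. destruct Ej as [m ->].
          rewrite !pow_mult. replace ((- x) ^ 2) with (x ^ 2) by ring. ring. }
  destruct (Req_dec (beta n) 0) as [|Hb]; [assumption|exfalso].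
  assert (Hb' : 0 < Rabs (beta n)) by now apply Rabs_pos_lt.
  (* Small enough for [|K| x <= |beta n|], which contradicts [2 |beta n| <= K x]. *)
  set (x := Rmin 1 (Rabs (beta n) / (Rabs K + 1))).
  assert (K0 := Rabs_pos K).
  assert (x0 : 0 < x).
  { apply Rmin_pos; [lra|]. apply Rdiv_lt_0_compat; lra. }
  assert (xK : x * (Rabs K + 1) <= Rabs (beta n)).
  { apply Rle_trans with (Rabs (beta n) / (Rabs K + 1) * (Rabs K + 1)).
    - apply Rmult_le_compat_r; [lra|apply Rmin_r].
    - right; field; lra. }
  assert (x1 : x <= 1) by apply Rmin_l.
  specialize (HK x (conj x0 x1)). rewrite E in HK.
  rewrite !Rabs_mult, (Rabs_pos_eq 2), (Rabs_pos_eq (x ^ n)) in HK by (try apply pow_le; lra).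
  assert (p0 : 0 < x ^ n) by now apply pow_lt.
  simpl in HK. rewrite <- Rmult_assoc in HK. apply Rmult_le_reg_r in HK; [|assumption].
  generalize (Rle_abs K). intros. nra.
Qed.

(** * The integrals of Wallis and Matsuoka, and Stirling's series *)

Definition wallis (n : nat) : R := RInt (fun x => cos x ^ n) 0 (PI / 2).

Lemma RInt_FTC (f df : R -> R) (a b : R) :
  (forall x, is_derive f x (df x)) -> (forall x, continuous df x) ->
  RInt df a b = f b - f a.
Proof.
  intros Hd Hc. apply is_RInt_unique.
  apply (is_RInt_derive f df); intros; [apply Hd|apply Hc].
Qed.

Ltac by_derive :=
  match goal with
  | |- continuous _ _ => apply (ex_derive_continuous (V := R_NormedModule)); auto_derive; auto
  | |- ex_RInt _ _ _ => apply (ex_RInt_continuous (V := R_CompleteNormedModule)); intros; by_derive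
  end.

Lemma RInt_sub_scal (f g : R -> R) (a b c d : R) :
  ex_RInt f a b -> ex_RInt g a b ->
  RInt (fun x => c * f x - d * g x) a b = c * RInt f a b - d * RInt g a b.
Proof.
  intros Hf Hg.
  apply is_RInt_unique, (is_RInt_minus (V := R_NormedModule));
    apply (is_RInt_scal (V := R_NormedModule)), (RInt_correct (V := R_CompleteNormedModule)); assumption.
Qed.

Lemma PI2_pos : 0 < PI / 2.
Proof. generalize PI_RGT_0; lra. Qed.

Lemma wallis_0 : wallis 0 = PI / 2.
Proof.
  unfold wallis. rewrite (RInt_FTC (fun x => x)); [ring| |]; intros x.
  - auto_derive; [exact I|]. reflexivity.
  - by_derive.
Qed.

Lemma wallis_1 : wallis 1 = 1.
Proof.
  unfold wallis. rewrite (RInt_FTC sin).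
  - rewrite sin_PI2, sin_0; ring.
  - intros x. auto_derive; [exact I|]. ring.
  - intros x. by_derive.
Qed.

Lemma wallis_rec n : INR (S (S n)) * wallis (S (S n)) = INR (S n) * wallis n.
Proof.
  assert (E : RInt (fun x => INR (S (S n)) * cos x ^ S (S n) - INR (S n) * cos x ^ n) 0 (PI / 2) = 0).
  { rewrite (RInt_FTC (fun x => sin x * cos x ^ S n)).
    - rewrite cos_PI2, sin_0. simpl; ring.
    - intros x. auto_derive; [exact I|].
      change (pred (S n)) with n.
      generalize (sin2_cos2 x). unfold Rsqr. intros Hsc.
      change (match n with O => 1 | S _ => INR n + 1 end) with (INR (S n)).
      cbn [pow]. rewrite !S_INR.
      match goal with |- ?a = ?b => apply Rminus_diag_uniq;
        replace (a - b) with ((INR n + 1) * cos x ^ n * (1 - (sin x * sin x + cos x * cos x))) by ring end.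
      rewrite Hsc. ring.
    - intros x. by_derive. }
  rewrite RInt_sub_scal in E; try by_derive.
  unfold wallis. apply Rminus_diag_uniq. exact E.
Qed.

Lemma cos_nonneg x : 0 < x < PI / 2 -> 0 < cos x.
Proof. intros. apply cos_gt_0; lra. Qed.

Lemma wallis_decr n : wallis (S n) <= wallis n.
Proof.
  apply RInt_le; [generalize PI2_pos; lra|by_derive|by_derive|].
  intros x Hx. generalize (cos_nonneg x Hx) (COS_bound x). intros.
  simpl. rewrite <- (Rmult_1_l (cos x ^ n)) at 2.
  apply Rmult_le_compat_r; [apply pow_le; lra|lra].
Qed.

Lemma wallis_pos n : 0 < wallis n /\ 0 < wallis (S n).
Proof.
  induction n as [|n [IH1 IH2]].
  - rewrite wallis_0, wallis_1. generalize PI2_pos; lra.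
  - split; [assumption|].
    generalize (wallis_rec n) (lt_0_INR (S n) ltac:(lia)) (lt_0_INR (S (S n)) ltac:(lia)). intros.
    apply Rmult_lt_reg_l with (INR (S (S n))); [assumption|].
    rewrite H. nra.
Qed.

Lemma wallis_prod n : INR (S n) * (wallis (S n) * wallis n) = PI / 2.
Proof.
  induction n as [|n IH].
  - rewrite wallis_0, wallis_1. simpl; ring.
  - rewrite <- IH, <- Rmult_assoc, wallis_rec. ring.
Qed.

Lemma wallis_even_fact n :
  wallis (2 * n) * (4 ^ n * INR (fact n) ^ 2) = PI / 2 * INR (fact (2 * n)).
Proof.
  induction n as [|n IH].
  - rewrite Nat.mul_0_r, wallis_0. simpl; ring.
  - replace (2 * S n)%nat with (S (S (2 * n))) by lia.
    generalize (wallis_rec (2 * n)). intros Hr.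
    rewrite !fact_simpl, !mult_INR.
    replace (INR (S (S (2 * n)))) with (2 * INR (S n)) in *
      by (rewrite !S_INR, mult_INR; simpl; ring).
    replace (wallis (S (S (2 * n))) * (4 ^ S n * (INR (S n) * INR (fact n)) ^ 2))
      with (2 * INR (S n) * wallis (S (S (2 * n))) * (2 * INR (S n) * (4 ^ n * INR (fact n) ^ 2)))
      by (simpl; ring).
    rewrite Hr.
    replace (INR (S (2 * n)) * wallis (2 * n) * (2 * INR (S n) * (4 ^ n * INR (fact n) ^ 2)))
      with (2 * INR (S n) * INR (S (2 * n)) * (wallis (2 * n) * (4 ^ n * INR (fact n) ^ 2))) by ring.
    rewrite IH. ring.
Qed.

Lemma is_lim_inv_S : is_lim_seq (fun n => / INR (S n)) 0.
Proof.
  apply (is_lim_seq_incr_1 (fun n => / INR n)).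
  replace (Finite 0) with (Rbar_inv p_infty) by reflexivity.
  apply is_lim_seq_inv; [apply is_lim_seq_INR|discriminate].
Qed.

(** [wallis_prod] gives the product of neighbouring integrals exactly, and by monotonicity the
    square of [wallis (2 n)] lies between two such products. *)
Lemma wallis_lim : is_lim_seq (fun n => INR (S n) * wallis (2 * S n) ^ 2) (PI / 4).
Proof.
  apply is_lim_seq_le_le with
    (u := fun n => PI / 4 - PI / 4 * / INR (S n)) (w := fun _ => PI / 4).
  - intros n. replace (2 * S n)%nat with (S (S (2 * n))) by lia.
    generalize (wallis_prod (S (S (2 * n)))) (wallis_prod (S (2 * n))).
    generalize (wallis_decr (S (S (2 * n)))) (wallis_decr (S (2 * n))).
    generalize (wallis_pos (S (2 * n))) (wallis_pos (S (S (2 * n)))).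
    generalize (wallis (S (S (S (2 * n))))) (wallis (S (S (2 * n)))) (wallis (S (2 * n))).
    intros a b c [Hc Hb] [_ Ha] H1 H2 E1 E2.
    rewrite !S_INR, mult_INR in *. simpl (INR 2) in *. simpl (b ^ 2). rewrite Rmult_1_r.
    assert (Hm := pos_INR n). assert (HPI := PI_RGT_0). revert E1 E2 Hm. generalize (INR n). intros m E1 E2 Hm.
    set (m' := m + 1). assert (Em : m = m' - 1) by (unfold m'; ring).
    assert (Hm' : 1 <= m') by (unfold m'; lra). clearbody m'. subst m.
    split.
    + apply Rmult_le_reg_r with (2 * (2 * m' + 1)); [lra|].
      apply Rle_trans with (m' * PI).
      * replace ((PI / 4 - PI / 4 * / m') * (2 * (2 * m' + 1)))
          with (m' * PI - PI / 2 - PI / (2 * m')) by (field; lra).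
        assert (0 < PI / (2 * m')) by (apply Rdiv_lt_0_compat; lra). lra.
      * assert (a * b <= b * b) by (apply Rmult_le_compat_r; lra).
        replace (m' * PI) with (m' * (2 * (PI / 2))) by field. rewrite <- E1.
        assert (0 <= m' * (2 * (2 * m' + 1))) by nra. nra.
    + assert (b * b <= b * c) by (apply Rmult_le_compat_l; lra). nra.
  - replace (Finite (PI / 4)) with (Finite (PI / 4 - PI / 4 * 0)) by (f_equal; ring).
    apply is_lim_seq_minus'; [apply is_lim_seq_const|].
    apply (is_lim_seq_scal_l _ _ 0), is_lim_inv_S.
  - apply is_lim_seq_const.
Qed.

(** [c = 2 c - c] is the limit of [2 u n - u (2 n)], where the growing terms combine and
    [n!^2 / (2 n)!] remains, a Wallis integral by [wallis_even_fact]. *)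
Lemma stirling_constant (c : R) :
  is_lim_seq (fun n => ln (INR (fact (S n))) -
    (INR (S n) * ln (INR (S n)) - INR (S n) + / 2 * ln (INR (S n)))) c ->
  c = / 2 * ln (2 * PI).
Proof.
  set (u := fun n => ln (INR (fact n)) - (INR n * ln (INR n) - INR n + / 2 * ln (INR n))).
  intros Hu. change (is_lim_seq (fun n => u (S n)) c) in Hu.
  assert (H2 : is_lim_seq (fun n => u (2 * S n)%nat) c).
  { apply (is_lim_seq_ext (fun n => (fun k => u (S k)) (2 * n + 1)%nat)).
    { intros n. now replace (S (2 * n + 1)) with (2 * S n)%nat by lia. }
    apply (is_lim_seq_subseq (fun k => u (S k)) c (fun n => (2 * n + 1)%nat)); [|exact Hu].
    apply eventually_subseq. intros; lia. }
  assert (H3 : is_lim_seq (fun n => 2 * u (S n) - u (2 * S n)%nat) (2 * c - c)).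
  { apply is_lim_seq_minus'; [|exact H2]. now apply (is_lim_seq_scal_l _ _ c). }
  assert (HPI := PI_RGT_0).
  assert (H4 : is_lim_seq (fun n => - / 2 * ln (INR (S n) * wallis (2 * S n) ^ 2)
      + (ln (PI / 2) + / 2 * ln 2))
      (- / 2 * ln (PI / 4) + (ln (PI / 2) + / 2 * ln 2))).
  { apply is_lim_seq_plus'; [|apply is_lim_seq_const].
    apply (is_lim_seq_scal_l _ _ (ln (PI / 4))).
    apply (is_lim_seq_continuous ln); [|exact wallis_lim].
    apply derivable_continuous_pt. exists (/ (PI / 4)). apply derivable_pt_lim_ln; lra. }
  assert (E : forall n, 2 * u (S n) - u (2 * S n)%nat =
    - / 2 * ln (INR (S n) * wallis (2 * S n) ^ 2) + (ln (PI / 2) + / 2 * ln 2)).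
  { intros n. unfold u.
    assert (W := wallis_even_fact (S n)).
    destruct (wallis_pos (2 * S n)) as [Wp _].
    assert (Fp := lt_0_INR _ (lt_O_fact (S n))). assert (Fp2 := lt_0_INR _ (lt_O_fact (2 * S n))).
    assert (Np := lt_0_INR (S n) ltac:(lia)).
    assert (l4 : ln 4 = 2 * ln 2).
    { replace 4 with (2 * 2) by ring. rewrite ln_mult; lra. }
    apply (f_equal ln) in W.
    rewrite (mult_INR 2 (S n)). change (INR 2) with 2.
    revert Wp W Fp2. generalize (wallis (2 * S n)) (fact (2 * S n)). intros w f2 Wp W Fp2.
    rewrite !ln_mult, !ln_pow in W by (try apply pow_lt; try apply Rmult_lt_0_compat; try apply pow_lt; lra).
    rewrite !ln_mult, ?ln_pow by (try apply pow_lt; lra).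
    change (INR 2) with 2 in *. rewrite l4 in W. nra. }
  apply (is_lim_seq_ext _ _ _ E) in H3.
  assert (Q := is_lim_seq_unique _ _ H3). rewrite (is_lim_seq_unique _ _ H4) in Q.
  injection Q. intros Q'. replace c with (2 * c - c) by ring. rewrite <- Q'.
  replace (PI / 4) with (PI / 2 / 2) by field.
  replace (2 * PI) with (PI / 2 * (2 * 2)) by field.
  rewrite ln_div, !ln_mult by lra. field.
Qed.

(** * Matsuoka's integrals and the value of [Li 2] at 1 *)

Definition basel_int (n : nat) : R := RInt (fun x => x ^ 2 * cos x ^ (2 * n)) 0 (PI / 2).

(** Two integrations by parts of [cos x ^ (2 n + 2)], collected in one antiderivative that vanishes
    at both ends. *)
Lemma basel_int_rec n :
  wallis (2 * S n) + INR (S n) * (INR (2 * S n) * basel_int (S n) - INR (2 * n + 1) * basel_int n) = 0.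
Proof.
  assert (E : RInt (fun x => 1 * cos x ^ (2 * S n) - - INR (S n) *
     (INR (2 * S n) * (x ^ 2 * cos x ^ (2 * S n)) - INR (2 * n + 1) * (x ^ 2 * cos x ^ (2 * n)))) 0 (PI / 2) = 0).
  { rewrite (RInt_FTC (fun x => x * cos x ^ (2 * S n) + INR (S n) * (x ^ 2 * sin x * cos x ^ (2 * n + 1)))).
    - rewrite cos_PI2, sin_0, (pow_i (2 * S n)), (pow_i (2 * n + 1)) by lia.
      match goal with |- ?a = ?b => change (@eq R a b) end. ring.
    - intros x. replace (2 * S n)%nat with (S (S (2 * n))) by lia.
      replace (2 * n + 1)%nat with (S (2 * n)) by lia.
      assert (Hm : INR (2 * n) = 2 * INR n) by (rewrite mult_INR; reflexivity).
      revert Hm. generalize (2 * n)%nat. intros m Hm.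
      auto_derive; [exact I|].
      change (pred (S m)) with m.
      change (match m with O => 1 | S _ => INR m + 1 end) with (INR (S m)).
      change (match n with O => 1 | S _ => INR n + 1 end) with (INR (S n)).
      generalize (sin2_cos2 x). unfold Rsqr. intros Hsc.
      cbn [pow pred]. rewrite !S_INR, Hm.
      match goal with |- ?a = ?b => apply Rminus_diag_uniq;
        replace (a - b) with ((INR n + 1) * x * x * (2 * INR n + 1) * cos x ^ m * (1 - (sin x * sin x + cos x * cos x))) by ring end.
      rewrite Hsc. ring.
    - intros x. by_derive. }
  rewrite RInt_sub_scal, RInt_sub_scal in E; try by_derive.
  unfold wallis, basel_int. lra.
Qed.

Lemma x_cos_le_sin x : 0 <= x <= PI / 2 -> x * cos x <= sin x.
Proof.
  intros Hx.
  assert (H : 0 <= (sin x - x * cos x) - (sin 0 - 0 * cos 0)); [|rewrite sin_0 in H; lra].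
  destruct (MVT_gen (fun x => sin x - x * cos x) 0 x (fun x => x * sin x)) as [c [Hc E]].
  - intros y _. auto_derive; [exact I|]. ring.
  - intros y _. apply derivable_continuous_pt. exists (y * sin y). apply is_derive_Reals.
    auto_derive; [exact I|]. ring.
  - rewrite Rmin_left, Rmax_right in Hc by lra. rewrite E.
    assert (0 <= sin c) by (apply sin_ge_0; generalize PI2_pos; lra).
    apply Rmult_le_pos; [|lra]. apply Rmult_le_pos; lra.
Qed.

(** By [x cos x <= sin x] the integrand is at most [cos^(2n) - cos^(2n+2)], whose integral is
    [wallis (2 n + 2) / (2 n + 1)]. The end term of the telescoping sum therefore tends to 0. *)
Lemma basel_int_bound n : 0 <= basel_int (S n) <= wallis (2 * S n) * / INR (S n).
Proof.
  assert (HP := PI2_pos). split.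
  - apply Rle_trans with (RInt (fun _ => 0) 0 (PI / 2)).
    + rewrite RInt_const. unfold scal; simpl; unfold mult; simpl. lra.
    + apply RInt_le; [lra|by_derive|by_derive|].
      intros x Hx. generalize (cos_nonneg x Hx). intros.
      apply Rmult_le_pos; apply pow_le; lra.
  - replace (2 * S n)%nat with (S (S (2 * n))) by lia.
    assert (Hr := wallis_rec (2 * n)).
    apply Rle_trans with (1 * wallis (2 * n) - 1 * wallis (S (S (2 * n)))).
    + unfold wallis. rewrite <- RInt_sub_scal by by_derive.
      apply RInt_le; [lra|by_derive|by_derive|].
      intros x Hx. generalize (cos_nonneg x Hx) (x_cos_le_sin x ltac:(lra)) (sin2_cos2 x).
      unfold Rsqr. intros Hc Hs E.
      replace (2 * S n)%nat with (S (S (2 * n))) by lia.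
      simpl. generalize (pow_lt _ (n + (n + 0)) Hc). intros p0.
      assert (x * cos x * (x * cos x) <= sin x * sin x) by (apply Rmult_le_compat; nra).
      nra.
    + destruct (wallis_pos (S (2 * n))) as [_ Hw].
      generalize (pos_INR n). intros Hn.
      rewrite !S_INR, mult_INR in *. change (INR 2) with 2 in Hr.
      apply Rmult_le_reg_r with ((2 * INR n + 1) * (INR n + 1)); [nra|].
      replace (wallis (S (S (2 * n))) * / (INR n + 1) * ((2 * INR n + 1) * (INR n + 1)))
        with (wallis (S (S (2 * n))) * (2 * INR n + 1)) by (field; lra).
      replace ((1 * wallis (2 * n) - 1 * wallis (S (S (2 * n)))) * ((2 * INR n + 1) * (INR n + 1)))
        with (((2 * INR n + 1) * wallis (2 * n) - (2 * INR n + 1) * wallis (S (S (2 * n)))) * (INR n + 1)) by ring.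
      rewrite <- Hr. nra.
Qed.

(** Matsuoka's proof: [1/n^2] telescopes as a difference of the ratios
    [basel_int n / wallis (2 n)]. *)
Lemma basel : is_series (fun n => / INR (S n) ^ 2) (PI ^ 2 / 6).
Proof.
  set (A := fun n => basel_int n / wallis (2 * n)).
  assert (T : forall n, / INR (S n) ^ 2 = 2 * A n - 2 * A (S n)).
  { intros n. unfold A. generalize (basel_int_rec n) (wallis_rec (2 * n)).
    destruct (wallis_pos (2 * n)) as [W1 _]. destruct (wallis_pos (2 * S n)) as [W2 _].
    revert W2. replace (2 * S n)%nat with (S (S (2 * n))) by lia.
    replace (2 * n + 1)%nat with (S (2 * n)) by lia.
    generalize (basel_int n) (basel_int (S n)) (wallis (2 * n)) W1 (wallis (S (S (2 * n)))).
    intros j j' w W1' w' W2. rewrite !S_INR, mult_INR. change (INR 2) with 2.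
    generalize (pos_INR n). generalize (INR n). intros m Hm E1 E2.
    assert (Hw : w = (2 * m + 2) * w' / (2 * m + 1)) by (apply (Rmult_eq_reg_l (2 * m + 1)); [|lra]; field_simplify; lra).
    assert (Hw' : w' = (m + 1) * ((2 * m + 1) * j - (2 * m + 2) * j')) by lra.
    assert (Hw0 : w' <> 0) by lra.
    transitivity (w' / (w' * (m + 1) ^ 2)); [field; split; lra|].
    rewrite Hw' at 1. rewrite Hw. field. repeat split; lra. }
  assert (S0 : forall n, sum_n (fun n => / INR (S n) ^ 2) n = 2 * A 0%nat - 2 * A (S n)).
  { induction n as [|n IH]; [rewrite sum_O; apply T|].
    rewrite sum_Sn, IH, T. unfold plus; simpl. lra. }
  assert (A0 : 2 * A 0%nat = PI ^ 2 / 6).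
  { unfold A. rewrite Nat.mul_0_r, wallis_0. unfold basel_int.
    rewrite (RInt_FTC (fun x => x ^ 3 / 3)).
    - field. apply PI_neq0.
    - intros x. auto_derive; [exact I|]. simpl; field.
    - intros x. by_derive. }
  change (is_lim_seq (sum_n (fun n => / INR (S n) ^ 2)) (PI ^ 2 / 6)).
  apply (is_lim_seq_ext (fun n => 2 * A 0%nat - 2 * A (S n))); [intros; now rewrite S0|].
  rewrite A0. replace (Finite (PI ^ 2 / 6)) with (Finite (PI ^ 2 / 6 - 2 * 0)) by (f_equal; ring).
  apply is_lim_seq_minus'; [apply is_lim_seq_const|]. apply (is_lim_seq_scal_l _ _ 0).
  apply is_lim_seq_le_le with (u := fun _ => 0) (w := fun n => / INR (S n));
    [|apply is_lim_seq_const|apply is_lim_inv_S].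
  intros n. unfold A. destruct (basel_int_bound n) as [H1 H2].
  destruct (wallis_pos (2 * S n)) as [W _]. split.
  - apply Rmult_le_pos; [assumption|]. left. now apply Rinv_0_lt_compat.
  - apply Rmult_le_reg_r with (wallis (2 * S n)); [assumption|].
    unfold Rdiv. rewrite Rmult_assoc, Rinv_l by lra. lra.
Qed.

(** The logarithm sits at index 1, with its primitive below and its derivatives above, because [emq]
    and the Euler-Maclaurin lemmas sum [H 1]. *)
Definition ln_tower (n : nat) (t : R) : R :=
  match n with
  | O => t * ln t - t
  | S O => ln t
  | S (S m) => (-1) ^ m * INR (fact m) * / t ^ S m
  end.

Lemma is_derive_ln_tower n t : 0 < t -> is_derive (ln_tower n) t (ln_tower (S n) t).
Proof.
  intros Ht. destruct n as [|[|m]].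
  - unfold ln_tower. auto_derive; [assumption|]. field; lra.
  - unfold ln_tower. auto_derive; [assumption|]. simpl; field; lra.
  - unfold ln_tower. rewrite fact_simpl, mult_INR. generalize (INR (fact m)). intros f.
    auto_derive; [apply (pow_nonzero t (S m)); lra|].
    change (pred (S m)) with m. change (match m with O => 1 | S _ => INR m + 1 end) with (INR (S m)).
    cbn [pow]. field. repeat split; try apply pow_nonzero; lra.
Qed.

Lemma ln_tower_scale m t : 0 < t -> ln_tower (S (S m)) t = ln_tower (S (S m)) 1 / t ^ S m.
Proof. intros. unfold ln_tower. rewrite pow1. field. apply pow_nonzero; lra. Qed.

(** An Euler-Maclaurin step of length 1. Its remainder, of order [x^-(L+2)], is majorised by a
    telescoping difference, so that summing over [k] needs no further estimate. The factor [2^(L+2)]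
    pays for [x + 1 <= 2 x]. *)
Lemma stirling_step L :
  exists c, forall k, 
   Rabs (emq (S (S L)) 1 ln_tower (INR (S (S k))) - emq (S (S L)) 1 ln_tower (INR (S k)) - ln (INR (S k)))
   <= c * (/ INR (S k) ^ S L - / INR (S (S k)) ^ S L).
Proof.
  set (B := rsum (S (S (S L))) (fun j => Rabs (beta j))).
  assert (HB : 0 <= B) by (apply rsum_nonneg; intros; apply Rabs_pos).
  exists (B * INR (fact (S L)) * 2 ^ S (S L)). intros k.
  rewrite (S_INR (S k)). assert (Hk : 1 <= INR (S k)) by (rewrite S_INR; generalize (pos_INR k); lra).
  generalize dependent (INR (S k)). intros x Hx.
  eapply Rle_trans.
  { generalize (euler_maclaurin_step (S L) ln_tower x 1 (INR (fact (S L)) * / x ^ S (S L))). intros E.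
    rewrite Rmult_1_l, pow1, Rmult_1_r in E. apply E; [lra| |].
    - intros j t Ht. apply is_derive_ln_tower; lra.
    - intros t Ht. unfold ln_tower. rewrite !Rabs_mult, pow_1_abs, Rmult_1_l, Rabs_pos_eq by apply pos_INR.
      apply Rmult_le_compat_l; [apply pos_INR|].
      rewrite Rabs_pos_eq by (left; apply Rinv_0_lt_compat, pow_lt; lra).
      apply Rinv_le_contravar; [apply pow_lt; lra|]. apply pow_incr; lra. }
  fold B. rewrite !Rmult_assoc. apply Rmult_le_compat_l; [assumption|].
  apply Rmult_le_compat_l; [apply pos_INR|].
  assert (p1 : 0 < x ^ L) by (apply pow_lt; lra). assert (p2 : 0 < (x + 1) ^ L) by (apply pow_lt; lra).
  assert (p3 : x ^ L <= (x + 1) ^ L) by (apply pow_incr; lra).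
  apply Rle_trans with (2 ^ S (S L) * / (x + 1) ^ S (S L)).
  - rewrite <- (Rinv_inv (2 ^ S (S L))), <- Rinv_mult.
    apply Rinv_le_contravar.
    + apply Rmult_lt_0_compat; [apply Rinv_0_lt_compat|]; apply pow_lt; lra.
    + rewrite <- pow_inv, <- Rpow_mult_distr. apply pow_incr; lra.
  - apply Rmult_le_compat_l; [apply pow_le; lra|].
    apply Rle_trans with (/ (x + 1) ^ L * (/ x - / (x + 1))).
    + simpl. rewrite !Rinv_mult.
      replace (/ x - / (x + 1)) with (/ x * / (x + 1)) by (field; lra).
      assert (/ (x + 1) <= / x) by (apply Rinv_le_contravar; lra).
      assert (0 < / (x + 1)) by (apply Rinv_0_lt_compat; lra).
      assert (0 < / (x + 1) ^ L) by now apply Rinv_0_lt_compat.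
      replace (/ (x + 1) * (/ (x + 1) * / (x + 1) ^ L)) with (/ (x + 1) ^ L * (/ (x + 1) * / (x + 1))) by ring.
      apply Rmult_le_compat_l; [lra|]. apply Rmult_le_compat_r; lra.
    + simpl. rewrite !Rinv_mult.
      assert (/ (x + 1) ^ L <= / x ^ L) by (now apply Rinv_le_contravar).
      assert (0 < / x) by (apply Rinv_0_lt_compat; lra).
      nra.
Qed.

(** The sequence [D + b] decreases and [D - b] increases, with a gap [2 b] that tends to 0; both
    enclose the limit. *)
Lemma telescoping_limit (D b : nat -> R) :
  (forall k, Rabs (D (S k) - D k) <= b k - b (S k)) ->
  is_lim_seq b 0 ->
  exists l : R, is_lim_seq D l /\ forall k, Rabs (D k - l) <= b k.
Proof.
  intros HD Hb.
  assert (Hst : forall k, - (b k - b (S k)) <= D (S k) - D k <= b k - b (S k))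
    by (intros k; apply Rabs_le_between, HD).
  assert (Hle : forall n k, D (n + k)%nat - b k + b (n + k)%nat <= D k /\ D k <= D (n + k)%nat + b k - b (n + k)%nat).
  { induction n as [|n IH]; intros k; simpl; [lra|].
    generalize (IH k) (Hst (n + k)%nat). lra. }
  assert (Hpos : forall k, 0 <= b k).
  { intros k. apply (is_lim_seq_le (fun n => b (n + k)%nat) (fun _ => b k) 0 (b k));
      [|now apply is_lim_seq_incr_n|apply is_lim_seq_const].
    intros n. generalize (Hle n k). lra. }
  destruct (ex_finite_lim_seq_decr (fun n => D n + b n) (D 0%nat - b 0%nat)) as [l Hl].
  - intros n. generalize (Hst n). lra.
  - intros n. generalize (Hle n 0%nat) (Hpos n). rewrite Nat.add_0_r. lra.
  - assert (HDl : is_lim_seq D l).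
    { apply (is_lim_seq_ext (fun n => D n + b n - b n)); [intros; ring|].
      replace (Finite l) with (Finite (l - 0)) by (f_equal; ring).
      now apply is_lim_seq_minus'. }
    exists l. split; [assumption|]. intros k.
    apply Rabs_le_between'. split.
    + apply (is_lim_seq_le (fun n => D (n + k)%nat - b k) (fun _ => D k) (l - b k) (D k)).
      * intros n. generalize (Hle n k) (Hpos (n + k)%nat). lra.
      * apply is_lim_seq_minus'; [|apply is_lim_seq_const]. now apply is_lim_seq_incr_n.
      * apply is_lim_seq_const.
    + apply (is_lim_seq_le (fun _ => D k) (fun n => D (n + k)%nat + b k) (D k) (l + b k)).
      * intros n. generalize (Hle n k) (Hpos (n + k)%nat). lra.
      * apply is_lim_seq_const.
      * apply is_lim_seq_plus'; [|apply is_lim_seq_const]. now apply is_lim_seq_incr_n.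
Qed.

Lemma is_lim_inv_pow L : is_lim_seq (fun k => / INR (S k) ^ S L) 0.
Proof.
  apply is_lim_seq_le_le with (u := fun _ => 0) (w := fun n => / INR (S n));
    [|apply is_lim_seq_const|apply is_lim_inv_S].
  intros n. assert (1 <= INR (S n)) by (rewrite S_INR; generalize (pos_INR n); lra).
  assert (1 <= INR (S n) ^ L) by (now apply pow_R1_Rle). split.
  - left. apply Rinv_0_lt_compat, pow_lt; lra.
  - apply Rinv_le_contravar; [lra|]. change (INR (S n) ^ S L) with (INR (S n) * INR (S n) ^ L). nra.
Qed.

Lemma ln_fact_rsum n : ln (INR (fact (S n))) = rsum n (fun k => ln (INR (S k))) + ln (INR (S n)).
Proof.
  induction n as [|n IH]; [simpl; ring|].
  rewrite fact_simpl, mult_INR, ln_mult, IH by (apply lt_0_INR; try lia; apply lt_O_fact).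
  rewrite rsum_S. ring.
Qed.

(** For [l >= 1] this is the classical coefficient [B_(l+1) / (l (l+1))]. It is kept as a product
    with [ln_tower] at 1 because that is the form in which it cancels later. Index 0 would be the
    logarithmic term, which is no power of [N]. *)
Definition stirling_term (l : nat) : R := if Nat.eqb l 0 then 0 else beta (S l) * ln_tower (S l) 1.

Lemma is_lim_stirling_sum n :
  is_lim_seq (fun k => rsum (S n) (fun l => stirling_term l / INR (S k) ^ l)) 0.
Proof.
  induction n as [|n IH].
  - apply (is_lim_seq_ext (fun _ => 0)); [|apply is_lim_seq_const].
    intros k. unfold stirling_term; simpl. field.
  - apply (is_lim_seq_ext (fun k => rsum (S n) (fun l => stirling_term l / INR (S k) ^ l)
       + stirling_term (S n) * / INR (S k) ^ S n)); [reflexivity|].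
    replace (Finite 0) with (Finite (0 + stirling_term (S n) * 0)) by (f_equal; ring).
    apply is_lim_seq_plus'; [exact IH|]. apply (is_lim_seq_scal_l _ _ 0), is_lim_inv_pow.
Qed.

Lemma stirling_series L :
  exists K, forall N, (1 <= N)%nat ->
  Rabs (ln (INR (fact N)) - (INR N * ln (INR N) - INR N + / 2 * ln (2 * PI * INR N)
         + rsum (S L) (fun l => stirling_term l / INR N ^ l))) <= K / INR N ^ S L.
Proof.
  destruct (stirling_step L) as [c Hc].
  set (D := fun k => emq (S (S L)) 1 ln_tower (INR (S k)) - rsum k (fun i => ln (INR (S i)))).
  destruct (telescoping_limit D (fun k => c * / INR (S k) ^ S L)) as [l [Hl HDl]].
  { intros k. unfold D. rewrite rsum_S.
    eapply Rle_trans; [|rewrite <- Rmult_minus_distr_l; apply (Hc k)].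
    right; f_equal; ring. }
  { replace (Finite 0) with (Finite (c * 0)) by (f_equal; ring).
    apply (is_lim_seq_scal_l _ _ 0), is_lim_inv_pow. }
  assert (ED : forall k, emq (S (S L)) 1 ln_tower (INR (S k)) =
     INR (S k) * ln (INR (S k)) - INR (S k) - / 2 * ln (INR (S k))
     + rsum (S (S L)) (fun l => stirling_term l / INR (S k) ^ l)).
  { intros k. assert (Hk := lt_0_INR (S k) ltac:(lia)).
    unfold emq. rewrite rsum_shift, rsum_shift, (rsum_shift (S L)).
    rewrite beta_0, beta_1. unfold stirling_term at 1. simpl (Nat.eqb 0 0).
    rewrite (rsum_ext (S L) (fun k0 => beta (S (S k0)) * _ * _) (fun l => stirling_term (S l) / INR (S k) ^ S l)).
    - cbn [ln_tower pow]. field.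
    - intros j _. unfold stirling_term. simpl (Nat.eqb (S j) 0). rewrite pow1, ln_tower_scale by assumption.
      field. apply pow_nonzero; lra. }
  assert (Z := is_lim_stirling_sum (S L)).
  assert (El : - l = / 2 * ln (2 * PI)).
  { apply stirling_constant.
    apply (is_lim_seq_ext (fun k => rsum (S (S L)) (fun l => stirling_term l / INR (S k) ^ l) - D k)).
    - intros k. unfold D. rewrite ED, ln_fact_rsum. field.
    - replace (Finite (- l)) with (Finite (0 - l)) by (f_equal; ring). now apply is_lim_seq_minus'. }
  (* The expansion [ED] contains one term more than the statement, of index [S L]; its coefficient
     is added to the error constant. *)
  exists (c + Rabs (stirling_term (S L))). intros [|k] HN; [lia|].
  specialize (HDl k). unfold D in HDl. rewrite ED, rsum_S in HDl.
  assert (Hk := lt_0_INR (S k) ltac:(lia)). assert (HPI := PI_RGT_0).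
  rewrite (ln_mult (2 * PI)) by lra. rewrite ln_fact_rsum.
  revert HDl.
  generalize (rsum k (fun i => ln (INR (S i)))) (rsum (S L) (fun l => stirling_term l / INR (S k) ^ l)).
  intros A B HDl.
  match goal with |- Rabs ?x <= _ => replace x with
    (- (INR (S k) * ln (INR (S k)) - INR (S k) - / 2 * ln (INR (S k)) + (B + stirling_term (S L) / INR (S k) ^ S L) - A - l)
      + stirling_term (S L) * / INR (S k) ^ S L) end.
  - eapply Rle_trans; [apply Rabs_triang|]. rewrite Rabs_Ropp, Rabs_mult.
    rewrite (Rabs_pos_eq (/ _)) by (left; apply Rinv_0_lt_compat, pow_lt; lra).
    unfold Rdiv. rewrite Rmult_plus_distr_r. apply Rplus_le_compat_r. exact HDl.
  - replace l with (- (/ 2 * ln (2 * PI))) by (rewrite <- El; ring). field. apply pow_nonzero; lra.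
Qed.

(** * Complex numbers and curves *)

Lemma CC_eq (z w : CC) : fst z = fst w -> snd z = snd w -> z = w.
Proof. destruct z, w; simpl; now intros -> ->. Qed.

Ltac cc := apply CC_eq; simpl; try ring.

Lemma CC_nonzero (z : CC) : z <> Czero -> fst z * fst z + snd z * snd z <> 0.
Proof.
  intros Hz E. apply Hz. apply CC_eq; simpl; nra.
Qed.

Lemma CC_field_theory : field_theory Czero Cone Cadd Cmul Csub Copp Cdiv Cinv (@eq CC).
Proof.
  constructor; [constructor| | |]; try solve [intros; cc].
  - intros E. apply (f_equal fst) in E. simpl in E. lra.
  - intros z Hz. apply CC_nonzero in Hz. apply CC_eq; simpl; now field.
Qed.

Add Field CC_field : CC_field_theory.

Lemma Cscal_RtoC r z : Cscal r z = Cmul (RtoC r) z.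
Proof. cc. Qed.

Lemma RtoC_plus a b : RtoC (a + b) = Cadd (RtoC a) (RtoC b).
Proof. cc. Qed.

Lemma RtoC_mult a b : RtoC (a * b) = Cmul (RtoC a) (RtoC b).
Proof. cc. Qed.

Lemma RtoC_opp a : RtoC (- a) = Copp (RtoC a).
Proof. cc. Qed.

Lemma RtoC_1 : RtoC 1 = Cone.
Proof. reflexivity. Qed.

Lemma RtoC_neq a : a <> 0 -> RtoC a <> Czero.
Proof. intros Ha E. apply Ha. exact (f_equal fst E). Qed.

Lemma RtoC_inv a : a <> 0 -> RtoC (/ a) = Cinv (RtoC a).
Proof. intros Ha. apply CC_eq; simpl; field; assumption. Qed.

Lemma Cmul_neq z w : z <> Czero -> w <> Czero -> Cmul z w <> Czero.
Proof.
  intros Hz Hw E. apply Hz.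
  replace z with (Cmul (Cmul z w) (Cinv w)) by (field; assumption).
  rewrite E. ring.
Qed.

Lemma Cnorm_nonneg z : 0 <= Cnorm z.
Proof. apply sqrt_pos. Qed.

Lemma Cnorm_sqr z : Cnorm z * Cnorm z = fst z * fst z + snd z * snd z.
Proof. apply sqrt_sqrt. nra. Qed.

Lemma Cnorm_mult z w : Cnorm (Cmul z w) = Cnorm z * Cnorm w.
Proof. unfold Cnorm. rewrite <- sqrt_mult by nra. f_equal; simpl; ring. Qed.

Lemma Cnorm_fst z : Rabs (fst z) <= Cnorm z.
Proof.
  apply Rsqr_incr_0_var; [|apply Cnorm_nonneg].
  rewrite <- Rsqr_abs. unfold Rsqr. rewrite Cnorm_sqr. nra.
Qed.

Lemma Cnorm_snd z : Rabs (snd z) <= Cnorm z.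
Proof.
  apply Rsqr_incr_0_var; [|apply Cnorm_nonneg].
  rewrite <- Rsqr_abs. unfold Rsqr. rewrite Cnorm_sqr. nra.
Qed.

Lemma Cnorm_le_sum z : Cnorm z <= Rabs (fst z) + Rabs (snd z).
Proof.
  generalize (Rabs_pos (fst z)) (Rabs_pos (snd z)). intros.
  apply Rsqr_incr_0_var; [|lra]. unfold Rsqr. rewrite Cnorm_sqr.
  generalize (Rsqr_abs (fst z)) (Rsqr_abs (snd z)). unfold Rsqr. intros. nra.
Qed.

Lemma Cnorm_triang z w : Cnorm (Cadd z w) <= Cnorm z + Cnorm w.
Proof.
  generalize (Cnorm_nonneg z) (Cnorm_nonneg w). intros Hz Hw.
  apply Rsqr_incr_0_var; [|lra]. unfold Rsqr. rewrite Cnorm_sqr.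
  replace ((Cnorm z + Cnorm w) * (Cnorm z + Cnorm w)) with
    (Cnorm z * Cnorm z + Cnorm w * Cnorm w + 2 * (Cnorm z * Cnorm w)) by ring.
  rewrite <- (Cnorm_mult z w), !Cnorm_sqr.
  (* [v] is [z] times the conjugate of [w]: it has the norm of [Cmul z w], and its real part is the
     inner product to be bounded. *)
  set (v := Cmul z (fst w, - snd w)).
  assert (Ev : Cnorm v = Cnorm (Cmul z w)).
  { unfold Cnorm, v. f_equal; simpl; ring. }
  generalize (Rle_abs (fst v)) (Cnorm_fst v). rewrite <- Ev.
  unfold v at 1 3; simpl. nra.
Qed.

Lemma Cnorm_opp z : Cnorm (Copp z) = Cnorm z.
Proof. unfold Cnorm. f_equal; simpl; ring. Qed.

Lemma Cnorm_RtoC r : Cnorm (RtoC r) = Rabs r.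
Proof.
  unfold Cnorm; simpl. replace (r * r + 0 * 0) with (Rsqr r) by (unfold Rsqr; ring).
  apply sqrt_Rsqr_abs.
Qed.

Lemma Cnorm_scal r z : Cnorm (Cscal r z) = Rabs r * Cnorm z.
Proof. now rewrite Cscal_RtoC, Cnorm_mult, Cnorm_RtoC. Qed.

Lemma Cnorm_Cexp z : Cnorm (Cexp z) = exp (fst z).
Proof.
  unfold Cnorm, Cexp; simpl.
  replace (_ + _) with (Rsqr (exp (fst z)) * (Rsqr (sin (snd z)) + Rsqr (cos (snd z)))) by (unfold Rsqr; ring).
  rewrite sin2_cos2, Rmult_1_r. apply sqrt_Rsqr. left; apply exp_pos.
Qed.

Lemma Cexp_add z w : Cexp (Cadd z w) = Cmul (Cexp z) (Cexp w).
Proof.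
  apply CC_eq; simpl; rewrite exp_plus.
  - rewrite cos_plus; ring.
  - rewrite sin_plus; ring.
Qed.

Lemma Cexp_RtoC r : Cexp (RtoC r) = RtoC (exp r).
Proof. apply CC_eq; simpl; rewrite ?cos_0, ?sin_0; ring. Qed.

Lemma Cexp_0 : Cexp Czero = Cone.
Proof. change Czero with (RtoC 0). rewrite Cexp_RtoC, exp_0. reflexivity. Qed.

Lemma Cexp_neq z : Cexp z <> Czero.
Proof.
  intros E. generalize (Cnorm_Cexp z) (exp_pos (fst z)). rewrite E.
  change Czero with (RtoC 0). rewrite Cnorm_RtoC, Rabs_R0. lra.
Qed.

Lemma Cexp_opp z : Cexp (Copp z) = Cinv (Cexp z).
Proof.
  assert (H := Cexp_neq z).
  replace (Cexp (Copp z)) with (Cmul (Cmul (Cexp (Copp z)) (Cexp z)) (Cinv (Cexp z))) by (field; assumption).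
  rewrite <- Cexp_add. replace (Cadd (Copp z) z) with Czero by ring.
  rewrite Cexp_0. ring.
Qed.

Lemma Cpow_Cexp z n : Cpow (Cexp z) n = Cexp (Cscal (INR n) z).
Proof.
  induction n as [|n IH].
  - simpl. rewrite <- Cexp_0. f_equal; cc.
  - cbn [Cpow]. rewrite IH, <- Cexp_add, S_INR. f_equal; cc.
Qed.

Lemma fst_Csum n f : fst (Csum n f) = rsum n (fun k => fst (f k)).
Proof. induction n as [|n IH]; simpl; [|rewrite IH]; reflexivity. Qed.

Lemma snd_Csum n f : snd (Csum n f) = rsum n (fun k => snd (f k)).
Proof. induction n as [|n IH]; simpl; [|rewrite IH]; reflexivity. Qed.

(** Derivative along a real parameter, taken componentwise: every rule below reduces to real
    calculus. *)
Definition cderiv (f : R -> CC) (t : R) (l : CC) : Prop :=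
  is_derive (fun s => fst (f s)) t (fst l) /\ is_derive (fun s => snd (f s)) t (snd l).

Lemma is_derive_Rmult (f g : R -> R) (t f' g' : R) :
  is_derive f t f' -> is_derive g t g' ->
  is_derive (fun s => f s * g s) t (f' * g t + f t * g').
Proof.
  intros Hf Hg. apply is_derive_Reals. apply derivable_pt_lim_mult; now apply is_derive_Reals.
Qed.

Lemma is_derive_eq (f : R -> R) (t l l' : R) : is_derive f t l -> l = l' -> is_derive f t l'.
Proof. now intros H <-. Qed.

Lemma cderiv_eq f t l l' : cderiv f t l -> l = l' -> cderiv f t l'.
Proof. now intros H <-. Qed.

Lemma cderiv_ext f g t l : (forall s, f s = g s) -> cderiv f t l -> cderiv g t l.
Proof.
  intros E [H1 H2].
  split; [apply (is_derive_ext (fun s => fst (f s)))|apply (is_derive_ext (fun s => snd (f s)))];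
    try assumption; intros s; now rewrite E.
Qed.

Lemma cderiv_const c t : cderiv (fun _ => c) t Czero.
Proof. split; apply @is_derive_const. Qed.

Lemma cderiv_add f g t f' g' :
  cderiv f t f' -> cderiv g t g' -> cderiv (fun s => Cadd (f s) (g s)) t (Cadd f' g').
Proof. intros [] []; split; now apply @is_derive_plus. Qed.

Lemma cderiv_opp f t f' : cderiv f t f' -> cderiv (fun s => Copp (f s)) t (Copp f').
Proof. intros []; split; now apply @is_derive_opp. Qed.

Lemma cderiv_sub f g t f' g' :
  cderiv f t f' -> cderiv g t g' -> cderiv (fun s => Csub (f s) (g s)) t (Csub f' g').
Proof. intros. apply cderiv_add; [assumption|]. now apply cderiv_opp. Qed.

Lemma cderiv_mul f g t f' g' :
  cderiv f t f' -> cderiv g t g' ->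
  cderiv (fun s => Cmul (f s) (g s)) t (Cadd (Cmul f' (g t)) (Cmul (f t) g')).
Proof.
  intros [F1 F2] [G1 G2]. split.
  - eapply is_derive_eq.
    + apply @is_derive_minus; apply is_derive_Rmult; eassumption.
    + unfold minus, plus, opp; simpl. ring.
  - eapply is_derive_eq.
    + apply @is_derive_plus; apply is_derive_Rmult; eassumption.
    + unfold plus; simpl. ring.
Qed.

Lemma cderiv_cmul c f t f' : cderiv f t f' -> cderiv (fun s => Cmul c (f s)) t (Cmul c f').
Proof.
  intros H. eapply cderiv_eq; [apply cderiv_mul; [apply cderiv_const|exact H]|]. cbn beta. ring.
Qed.

Lemma cderiv_RtoC (f : R -> R) t f' : is_derive f t f' -> cderiv (fun s => RtoC (f s)) t (RtoC f').
Proof. intros H; split; [exact H|]. apply (is_derive_const (K := R_AbsRing) (V := R_NormedModule) 0). Qed.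

Lemma cderiv_line z t : cderiv (fun s => Cscal s z) t z.
Proof. split; simpl; (auto_derive; [exact I|ring]). Qed.

Lemma cderiv_inv f t f' :
  f t <> Czero -> cderiv f t f' ->
  cderiv (fun s => Cinv (f s)) t (Copp (Cmul (Cmul (Cinv (f t)) (Cinv (f t))) f')).
Proof.
  intros Hn [F1 F2]. apply CC_nonzero in Hn.
  assert (D : is_derive (fun s => / (fst (f s) * fst (f s) + snd (f s) * snd (f s))) t
    (- (2 * (fst f' * fst (f t) + snd f' * snd (f t))) /
       (fst (f t) * fst (f t) + snd (f t) * snd (f t)) ^ 2)).
  { apply (is_derive_inv (fun s => fst (f s) * fst (f s) + snd (f s) * snd (f s))); [|assumption].
    eapply is_derive_eq; [apply @is_derive_plus; apply is_derive_Rmult; eassumption|].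
    unfold plus; simpl. ring. }
  split.
  - eapply is_derive_eq; [apply is_derive_Rmult; [exact F1|exact D]|]. simpl. now field.
  - eapply is_derive_eq; [apply is_derive_Rmult; [apply @is_derive_opp, F2|exact D]|].
    simpl. unfold opp; simpl. now field.
Qed.

Lemma cderiv_Cexp f t f' :
  cderiv f t f' -> cderiv (fun s => Cexp (f s)) t (Cmul f' (Cexp (f t))).
Proof.
  intros [F1 F2].
  assert (E : is_derive (fun s => exp (fst (f s))) t (fst f' * exp (fst (f t)))).
  { apply (is_derive_comp exp (fun s => fst (f s))); [apply is_derive_exp|assumption]. }
  assert (C : is_derive (fun s => cos (snd (f s))) t (snd f' * - sin (snd (f t)))).
  { apply (is_derive_comp cos (fun s => snd (f s))); [apply is_derive_cos|assumption]. }
  assert (S : is_derive (fun s => sin (snd (f s))) t (snd f' * cos (snd (f t)))).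
  { apply (is_derive_comp sin (fun s => snd (f s))); [apply is_derive_sin|assumption]. }
  split; (eapply is_derive_eq; [apply is_derive_Rmult; eassumption|simpl; ring]).
Qed.

Lemma cderiv_reflect f t f' :
  cderiv f (- t) f' -> cderiv (fun s => f (- s)) t (Copp f').
Proof.
  intros [F1 F2].
  assert (N : is_derive (fun s => - s) t (- 1)) by (auto_derive; [exact I|ring]).
  split.
  - eapply is_derive_eq; [apply (is_derive_comp (fun s => fst (f s)) Ropp); [exact F1|exact N]|].
    simpl; unfold scal; simpl; unfold mult; simpl; ring.
  - eapply is_derive_eq; [apply (is_derive_comp (fun s => snd (f s)) Ropp); [exact F2|exact N]|].
    simpl; unfold scal; simpl; unfold mult; simpl; ring.
Qed.

(** Together with [cderiv_ext_loc] this allows both sides of an identity between curves to be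
    differentiated. *)
Lemma cderiv_unique f t l l' : cderiv f t l -> cderiv f t l' -> l = l'.
Proof.
  intros [A1 A2] [B1 B2]. apply is_derive_unique in A1, A2, B1, B2.
  apply CC_eq; congruence.
Qed.

Lemma cderiv_ext_loc f g t l :
  locally t (fun s => f s = g s) -> cderiv f t l -> cderiv g t l.
Proof.
  intros E [H1 H2].
  split; [apply (is_derive_ext_loc (fun s => fst (f s)))|apply (is_derive_ext_loc (fun s => snd (f s)))];
    try assumption; (eapply filter_imp; [|exact E]); intros s Hs; cbn beta; now rewrite Hs.
Qed.

Lemma locally_pos t : 0 < t -> locally t (fun s => 0 < s).
Proof. intros Ht. apply (open_gt 0 t Ht). Qed.

(** Closed forms of curves are all derived from this: a suitable combination has derivative 0, and
    its value is read off at one point or in a limit. *)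
Lemma cderiv_zero_const f a b :
  (forall t, a <= t <= b -> cderiv f t Czero) -> a <= b -> f a = f b.
Proof.
  intros H Hab. destruct (Req_dec a b) as [->|Hne]; [reflexivity|].
  apply CC_eq.
  - apply (eq_is_derive (fun s => fst (f s))); [|lra]. intros t Ht. apply (H t Ht).
  - apply (eq_is_derive (fun s => snd (f s))); [|lra]. intros t Ht. apply (H t Ht).
Qed.

(** * Polylogarithms along rays *)

Lemma ex_series_abs_le (a b : nat -> R) :
  (forall n, Rabs (a n) <= b n) -> ex_series b -> ex_series a.
Proof. exact (@ex_series_le R_AbsRing R_CompleteNormedModule a b). Qed.

Lemma ex_series_Rscal (c : R) (a : nat -> R) : ex_series a -> ex_series (fun n => c * a n).
Proof. exact (@ex_series_scal_l R_AbsRing R_NormedModule c a). Qed.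

Lemma is_series_Rscal (c : R) (a : nat -> R) (l : R) :
  is_series a l -> is_series (fun n => c * a n) (c * l).
Proof. exact (@is_series_scal_l R_AbsRing R_NormedModule c a l). Qed.

Lemma Series_zero : Series (fun _ : nat => 0) = 0.
Proof.
  rewrite (Series_ext _ (fun _ => 0 * 0)) by (intros; ring). rewrite Series_scal_l. ring.
Qed.

Lemma Series_abs_le (a b : nat -> R) :
  (forall n, Rabs (a n) <= b n) -> ex_series b -> Rabs (Series a) <= Series b.
Proof.
  intros H Hb.
  assert (ex_series (fun n => Rabs (a n))).
  { apply ex_series_abs_le with b; [|assumption]. intros n. now rewrite Rabs_Rabsolu. }
  eapply Rle_trans; [now apply Series_Rabs|].
  apply Series_le; [|assumption]. intros n. split; [apply Rabs_pos|apply H].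
Qed.

Lemma sum_n_rsum (a : nat -> R) n : sum_n a n = rsum (S n) a.
Proof.
  induction n as [|n IH]; [rewrite sum_O; simpl; ring|].
  rewrite sum_Sn, IH. reflexivity.
Qed.

(** [epsilon] picks some limit of the partial sums, and uniqueness of limits leaves only this
    one. *)
Lemma Cseries_eq (a : nat -> CC) :
  ex_series (fun n => fst (a n)) -> ex_series (fun n => snd (a n)) ->
  Cseries a = (Series (fun n => fst (a n)), Series (fun n => snd (a n))).
Proof.
  intros H1 H2.
  assert (P : Cseries_converges_to a (Series (fun n => fst (a n)), Series (fun n => snd (a n)))).
  { split; apply is_lim_seq_Reals.
    - apply (is_lim_seq_ext (sum_n (fun n => fst (a n)))); [|now apply Series_correct].
      intros n. now rewrite sum_n_rsum, fst_Csum.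
    - apply (is_lim_seq_ext (sum_n (fun n => snd (a n)))); [|now apply Series_correct].
      intros n. now rewrite sum_n_rsum, snd_Csum. }
  assert (Q := epsilon_spec (inhabits Czero) (fun l => Cseries_converges_to a l) (ex_intro _ _ P)).
  fold (Cseries a) in Q. destruct P, Q. apply CC_eq; eapply UL_sequence; eassumption.
Qed.

(** With second derivatives dominated by the summable [M], each first-order remainder is at most
    [M n * h^2], hence their sum is [O(h^2)]. *)
Lemma is_derive_Series (f g k : nat -> R -> R) (M : nat -> R) (t r : R) :
  0 < r ->
  (forall n s, t - r <= s <= t + r -> is_derive (f n) s (g n s)) ->
  (forall n s, t - r <= s <= t + r -> is_derive (g n) s (k n s)) ->
  (forall n s, t - r <= s <= t + r -> Rabs (k n s) <= M n) ->
  ex_series M ->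
  (forall s, t - r <= s <= t + r -> ex_series (fun n => f n s)) ->
  ex_series (fun n => g n t) ->
  is_derive (fun s => Series (fun n => f n s)) t (Series (fun n => g n t)).
Proof.
  intros Hr Hf Hg Hk HM Sf Sg.
  assert (MV : forall (u du : R -> R) s, t - r <= s <= t + r ->
     (forall x, t - r <= x <= t + r -> is_derive u x (du x)) ->
     exists c, t - r <= c <= t + r /\ Rabs (c - t) <= Rabs (s - t) /\ u s - u t = du c * (s - t)).
  { intros u du s Hs Hu.
    assert (Hb : forall x, Rmin t s <= x <= Rmax t s -> t - r <= x <= t + r).
    { intros x. unfold Rmin, Rmax. destruct (Rle_dec t s); lra. }
    destruct (MVT_gen u t s du) as [c [Hc E]].
    - intros x Hx. apply Hu, Hb; lra.
    - intros x Hx. apply derivable_continuous_pt. exists (du x). apply is_derive_Reals, Hu, Hb, Hx.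
    - exists c. split; [now apply Hb|]. split; [|exact E].
      revert Hc. unfold Rmin, Rmax, Rabs.
      destruct (Rle_dec t s); destruct (Rcase_abs (c - t)), (Rcase_abs (s - t)); lra. }
  assert (M0 : forall n, 0 <= M n).
  { intros n. eapply Rle_trans; [apply Rabs_pos|]. apply (Hk n t); lra. }
  assert (R2 : forall n h, Rabs h <= r -> Rabs (f n (t + h) - f n t - h * g n t) <= M n * (h * h)).
  { intros n h Hh. apply Rabs_le_between in Hh.
    destruct (MV (f n) (g n) (t + h) ltac:(lra) (Hf n)) as [c [Hc [Hc' E]]].
    destruct (MV (g n) (k n) c Hc (Hg n)) as [c2 [Hc2 [_ E2]]].
    rewrite E. replace (t + h - t) with h in * by ring.
    replace (g n c * h - h * g n t) with (k n c2 * ((c - t) * h)) by (rewrite <- Rmult_assoc, <- E2; ring).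
    rewrite Rabs_mult. apply Rmult_le_compat; try apply Rabs_pos; [now apply Hk|].
    rewrite Rabs_mult. replace (h * h) with (Rabs h * Rabs h) by (rewrite <- Rabs_mult; apply Rabs_pos_eq; nra).
    apply Rmult_le_compat_r; [apply Rabs_pos|assumption]. }
  apply is_derive_Reals. intros eps Heps.
  set (S0 := Series M).
  assert (HS0 : 0 <= S0).
  { unfold S0. rewrite <- Series_zero.
    apply Series_le; [|assumption]. intros n. split; [lra|apply M0]. }
  assert (Hd : 0 < Rmin r (eps / (S0 + 1))).
  { apply Rmin_pos; [assumption|]. apply Rdiv_lt_0_compat; lra. }
  exists (mkposreal _ Hd). intros h Hh0 Hh. simpl in Hh.
  assert (Hh1 : Rabs h < r) by (eapply Rlt_le_trans; [exact Hh|apply Rmin_l]).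
  assert (Hh2 : Rabs h < eps / (S0 + 1)) by (eapply Rlt_le_trans; [exact Hh|apply Rmin_r]).
  assert (Hh' := Hh1). apply Rabs_lt_between in Hh'.
  assert (Hp : 0 < Rabs h) by now apply Rabs_pos_lt.
  replace ((Series (fun n => f n (t + h)) - Series (fun n => f n t)) / h - Series (fun n => g n t))
    with (Series (fun n => f n (t + h) - f n t - h * g n t) / h).
  - unfold Rdiv at 1. rewrite Rabs_mult, Rabs_inv.
    apply Rmult_lt_reg_r with (Rabs h); [assumption|].
    rewrite Rmult_assoc, Rinv_l, Rmult_1_r by lra.
    apply Rle_lt_trans with (Series (fun n => M n * (h * h))).
    + apply Series_abs_le; [intros n; apply R2; lra|]. now apply ex_series_scal_r.
    + rewrite Series_scal_r. fold S0.
      replace (h * h) with (Rabs h * Rabs h) by (rewrite <- Rabs_mult; apply Rabs_pos_eq; nra).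
      rewrite <- Rmult_assoc. apply Rmult_lt_compat_r; [assumption|].
      apply Rle_lt_trans with ((S0 + 1) * Rabs h); [nra|].
      apply Rmult_lt_reg_r with (/ (S0 + 1)); [apply Rinv_0_lt_compat; lra|].
      replace ((S0 + 1) * Rabs h * / (S0 + 1)) with (Rabs h) by (field; lra). exact Hh2.
  - rewrite Series_minus, Series_minus, Series_scal_l.
    + field. assumption.
    + apply Sf; lra.
    + apply Sf; lra.
    + apply (ex_series_minus (V := R_NormedModule)); apply Sf; lra.
    + apply ex_series_Rscal; assumption.
Qed.

(** Tannery's theorem: beyond an index where the tail of [b] is below [eps / 4] both series are
    negligible, and the finite parts converge. *)
Lemma Series_dominated (a : nat -> nat -> R) (l b : nat -> R) :
  (forall k n, Rabs (a k n) <= b n) -> ex_series b ->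
  (forall n, is_lim_seq (fun k => a k n) (l n)) ->
  is_lim_seq (fun k => Series (a k)) (Series l).
Proof.
  intros Ha Hb Hl.
  assert (Hlb : forall n, Rabs (l n) <= b n).
  { intros n. apply (is_lim_seq_le (fun k => Rabs (a k n)) (fun _ => b n) (Rabs (l n)) (b n)).
    - intros k. apply Ha.
    - apply (is_lim_seq_abs _ (l n)), Hl.
    - apply is_lim_seq_const. }
  assert (Sa : forall k, ex_series (a k)) by (intros k; now apply ex_series_abs_le with b).
  assert (Sl : ex_series l) by (now apply ex_series_abs_le with b).
  assert (Htail : forall m u, (forall n, Rabs (u n) <= b n) ->
     Rabs (Series u - rsum (S m) u) <= Series b - rsum (S m) b).
  { intros m u Hu. assert (Su : ex_series u) by (now apply ex_series_abs_le with b).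
    rewrite (Series_incr_n u (S m)), (Series_incr_n b (S m)) by (try lia; assumption).
    rewrite <- !sum_n_Reals, !sum_n_rsum. simpl (pred (S m)).
    replace (rsum (S m) u + Series (fun k => u (S m + k)%nat) - rsum (S m) u)
      with (Series (fun k => u (S m + k)%nat)) by ring.
    replace (rsum (S m) b + Series (fun k => b (S m + k)%nat) - rsum (S m) b)
      with (Series (fun k => b (S m + k)%nat)) by ring.
    apply Series_abs_le; [intros n; apply Hu|]. now apply ex_series_incr_n. }
  apply is_lim_seq_spec. intros eps.
  assert (Hb' := Series_correct b Hb).
  apply (is_lim_seq_spec (sum_n b) (Series b)) in Hb'.
  destruct (Hb' (pos_div_2 (pos_div_2 eps))) as [m Hm]. specialize (Hm m (Nat.le_refl m)).
  rewrite sum_n_rsum in Hm. simpl in Hm.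
  assert (Hf : is_lim_seq (fun k => rsum (S m) (a k)) (rsum (S m) l)).
  { clear -Hl. induction (S m) as [|n IH]; [apply is_lim_seq_const|].
    simpl. now apply is_lim_seq_plus'. }
  apply is_lim_seq_spec in Hf. destruct (Hf (pos_div_2 eps)) as [N HN].
  exists N. intros k Hk. specialize (HN k Hk). simpl in HN.
  generalize (Htail m (a k) (Ha k)) (Htail m l Hlb). intros T1 T2.
  change (rsum m b + b m) with (rsum (S m) b) in Hm.
  apply Rabs_lt_between in Hm. apply Rabs_le_between in T1. apply Rabs_le_between in T2.
  change (rsum m (a k) + a k m) with (rsum (S m) (a k)) in HN.
  change (rsum m l + l m) with (rsum (S m) l) in HN.
  apply Rabs_lt_between in HN. apply Rabs_lt_between. lra.
Qed.

Lemma ex_series_pow_geom K rho : 0 < rho < 1 -> ex_series (fun n => INR (S n) ^ K * rho ^ S n).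
Proof.
  intros Hrho.
  assert (Hp : forall n, 0 < INR (S n) ^ K * rho ^ S n).
  { intros n. apply Rmult_lt_0_compat; apply pow_lt; [apply lt_0_INR; lia|lra]. }
  apply (ex_series_ext (fun n => Rabs (INR (S n) ^ K * rho ^ S n))).
  { intros n. apply Rabs_pos_eq. left; apply Hp. }
  apply ex_series_DAlembert with rho; [lra| |].
  - intros n. generalize (Hp n). lra.
  - apply (is_lim_seq_ext (fun n => (1 + / INR (S n)) ^ K * rho)).
    + intros n. rewrite Rabs_pos_eq.
      * assert (0 < INR (S n)) by (apply lt_0_INR; lia).
        rewrite (S_INR (S n)). change (rho ^ S (S n)) with (rho * rho ^ S n).
        replace (1 + / INR (S n)) with ((INR (S n) + 1) * / INR (S n)) by (field; lra).
        rewrite Rpow_mult_distr, pow_inv. field. split; apply pow_nonzero; lra.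
      * left. apply Rdiv_lt_0_compat; apply Hp.
    + replace (Finite rho) with (Finite ((1 + 0) ^ K * rho)) by (f_equal; rewrite Rplus_0_r, pow1; ring).
      apply is_lim_seq_mult'; [|apply is_lim_seq_const].
      apply (is_lim_seq_continuous (fun x => x ^ K)).
      * apply derivable_continuous_pt, derivable_pt_pow.
      * apply is_lim_seq_plus'; [apply is_lim_seq_const|apply is_lim_inv_S].
Qed.

(** [Z.to_nat] maps negative exponents to 0, where the bound is 1; thus one polynomial bound serves
    polylogarithms of every order. *)
Lemma powerRZ_INR_le e n : 0 <= powerRZ (INR (S n)) e <= INR (S n) ^ Z.to_nat e.
Proof.
  assert (H : 1 <= INR (S n)) by (rewrite S_INR; generalize (pos_INR n); lra).
  split; [apply powerRZ_le; lra|].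
  destruct e as [|p|p]; cbn [powerRZ Z.to_nat pow].
  - lra.
  - apply Rle_refl.
  - rewrite <- Rinv_1. apply Rinv_le_contravar; [lra|]. apply pow_R1_Rle; lra.
Qed.

Lemma exp_mult_INR x n : exp (x * INR n) = exp x ^ n.
Proof.
  induction n as [|n IH]; [simpl; rewrite Rmult_0_r; apply exp_0|].
  rewrite S_INR, Rmult_plus_distr_l, exp_plus, IH, Rmult_1_r. simpl; ring.
Qed.

(** [e] is minus the order of the polylogarithm. The power of the exponential is merged into a
    single exponential in [t], so that [d/dt] just multiplies by [z] and raises [e] by one. *)
Definition Li_term (e : Z) (z : CC) (n : nat) (t : R) : CC :=
  Cscal (powerRZ (INR (S n)) e) (Cexp (Cscal t (Cscal (INR (S n)) z))).

Lemma Li_as_terms s z t : Li s (Cexp (Cscal t z)) = Cseries (fun n => Li_term (- s) z n t).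
Proof.
  unfold Li. f_equal. apply functional_extensionality. intros n. unfold Li_term.
  rewrite Cpow_Cexp. do 2 f_equal. cc.
Qed.

Lemma Cnorm_Li_term e z n t t0 :
  Cre z < 0 -> 0 < t0 <= t ->
  Cnorm (Li_term e z n t) <= INR (S n) ^ Z.to_nat e * exp (t0 * Cre z) ^ S n.
Proof.
  intros Hz Ht. unfold Li_term. rewrite Cnorm_scal, Cnorm_Cexp.
  destruct (powerRZ_INR_le e n) as [P1 P2]. rewrite Rabs_pos_eq by assumption.
  apply Rmult_le_compat; [assumption|left; apply exp_pos|assumption|].
  rewrite <- exp_mult_INR.
  unfold Cre in *. cbn [fst Cscal]. assert (0 < INR (S n)) by (apply lt_0_INR; lia).
  assert (E : t * (INR (S n) * fst z) <= t0 * fst z * INR (S n)).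
  { assert (INR (S n) * fst z < 0) by nra. nra. }
  destruct E as [E|E]; [left; now apply exp_increasing|right; now rewrite E].
Qed.

Lemma exp_neg_lt1 x : x < 0 -> 0 < exp x < 1.
Proof. intros Hx. split; [apply exp_pos|]. rewrite <- exp_0. now apply exp_increasing. Qed.

Lemma ex_series_Li_bound e z t0 : Cre z < 0 -> 0 < t0 ->
  ex_series (fun n => INR (S n) ^ Z.to_nat e * exp (t0 * Cre z) ^ S n).
Proof. intros Hz Ht. apply ex_series_pow_geom, exp_neg_lt1. nra. Qed.

Lemma ex_series_Li_term e z t : Cre z < 0 -> 0 < t ->
  ex_series (fun n => fst (Li_term e z n t)) /\ ex_series (fun n => snd (Li_term e z n t)).
Proof.
  intros Hz Ht.
  split; (eapply ex_series_abs_le; [|apply (ex_series_Li_bound e z t Hz Ht)]); intros n;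
    (eapply Rle_trans; [|apply (Cnorm_Li_term e z n t t Hz); lra]); [apply Cnorm_fst|apply Cnorm_snd].
Qed.

Lemma Li_eq s z t : Cre z < 0 -> 0 < t ->
  Li s (Cexp (Cscal t z)) =
  (Series (fun n => fst (Li_term (- s) z n t)), Series (fun n => snd (Li_term (- s) z n t))).
Proof.
  intros Hz Ht. rewrite Li_as_terms.
  destruct (ex_series_Li_term (- s) z t Hz Ht). now apply Cseries_eq.
Qed.

Lemma cderiv_Li_term e z n t :
  cderiv (Li_term e z n) t (Cmul z (Li_term (e + 1) z n t)).
Proof.
  eapply cderiv_eq.
  - eapply cderiv_ext; [|apply (cderiv_cmul (RtoC (powerRZ (INR (S n)) e))), cderiv_Cexp, cderiv_line].
    intros s. unfold Li_term. symmetry; apply Cscal_RtoC.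
  - cbn beta. unfold Li_term. rewrite powerRZ_add by (apply not_0_INR; lia).
    rewrite powerRZ_1, !Cscal_RtoC, RtoC_mult. ring.
Qed.

Lemma cderiv_Li s z t : Cre z < 0 -> 0 < t ->
  cderiv (fun t => Li s (Cexp (Cscal t z))) t (Cmul z (Li (s - 1) (Cexp (Cscal t z)))).
Proof.
  intros Hz Ht.
  apply (cderiv_ext_loc (fun t => (Series (fun n => fst (Li_term (- s) z n t)), Series (fun n => snd (Li_term (- s) z n t))))).
  { eapply filter_imp; [|apply (locally_pos t Ht)]. intros x Hx. now rewrite Li_eq. }
  assert (E1 := ex_series_Li_term (- s + 1) z t Hz Ht).
  rewrite Li_eq by assumption. replace (- (s - 1))%Z with (- s + 1)%Z by ring.
  set (e := (- s)%Z) in *. destruct E1 as [E1 E2].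
  (* Second derivatives raise the exponent by two; [t / 2] is the left end of the interval around
     [t], where the exponentials are largest. *)
  set (b := fun n => Cnorm z * Cnorm z * (INR (S n) ^ Z.to_nat (e + 1 + 1) * exp (t / 2 * Cre z) ^ S n)).
  assert (Hb : ex_series b).
  { apply ex_series_Rscal. apply ex_series_Li_bound; lra. }
  assert (Hbd : forall n s, t - t / 2 <= s <= t + t / 2 ->
     Cnorm (Cmul z (Cmul z (Li_term (e + 1 + 1) z n s))) <= b n).
  { intros n x Hx. rewrite !Cnorm_mult, <- Rmult_assoc.
    apply Rmult_le_compat_l.
    - generalize (Cnorm_nonneg z). nra.
    - apply Cnorm_Li_term; lra. }
  assert (Hg : forall n x, cderiv (fun x => Cmul z (Li_term (e + 1) z n x)) x
     (Cmul z (Cmul z (Li_term (e + 1 + 1) z n x)))).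
  { intros n x. apply cderiv_cmul, cderiv_Li_term. }
  assert (L1 : is_series (fun n => fst (Cmul z (Li_term (e + 1) z n t)))
     (fst z * Series (fun n => fst (Li_term (e + 1) z n t)) - snd z * Series (fun n => snd (Li_term (e + 1) z n t)))).
  { apply (is_series_minus (V := R_NormedModule)); apply is_series_Rscal;
      now apply Series_correct. }
  assert (L2 : is_series (fun n => snd (Cmul z (Li_term (e + 1) z n t)))
     (fst z * Series (fun n => snd (Li_term (e + 1) z n t)) + snd z * Series (fun n => fst (Li_term (e + 1) z n t)))).
  { apply (is_series_plus (V := R_NormedModule)); apply is_series_Rscal;
      now apply Series_correct. }
  split; cbn [fst snd Cmul].
  - rewrite <- (is_series_unique _ _ L1).
    apply (is_derive_Series (fun n t => fst (Li_term e z n t))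
      (fun n t => fst (Cmul z (Li_term (e + 1) z n t)))
      (fun n x => fst (Cmul z (Cmul z (Li_term (e + 1 + 1) z n x)))) b t (t / 2)); [lra| | | |exact Hb| |].
    + intros n x _. apply (cderiv_Li_term e z n x).
    + intros n x _. apply (Hg n x).
    + intros n x Hx. eapply Rle_trans; [apply Cnorm_fst|now apply Hbd].
    + intros x Hx. apply (ex_series_Li_term e z x); lra.
    + eexists; exact L1.
  - rewrite <- (is_series_unique _ _ L2).
    apply (is_derive_Series (fun n t => snd (Li_term e z n t))
      (fun n t => snd (Cmul z (Li_term (e + 1) z n t)))
      (fun n x => snd (Cmul z (Cmul z (Li_term (e + 1 + 1) z n x)))) b t (t / 2)); [lra| | | |exact Hb| |].
    + intros n x _. apply (cderiv_Li_term e z n x).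
    + intros n x _. apply (Hg n x).
    + intros n x Hx. eapply Rle_trans; [apply Cnorm_snd|now apply Hbd].
    + intros x Hx. apply (ex_series_Li_term e z x); lra.
    + eexists; exact L2.
Qed.

(** Geometric series: shifting the index multiplies by [q], so the sum [S] satisfies
    [S = q + q S]. *)
Lemma Li_0 z t : Cre z < 0 -> 0 < t ->
  Cmul (Li 0 (Cexp (Cscal t z))) (Csub Cone (Cexp (Cscal t z))) = Cexp (Cscal t z).
Proof.
  intros Hz Ht. rewrite Li_eq by assumption. change (- 0)%Z with 0%Z.
  destruct (ex_series_Li_term 0 z t Hz Ht) as [E1 E2].
  set (q := Cexp (Cscal t z)).
  assert (R0 : forall n, Li_term 0 z (S n) t = Cmul q (Li_term 0 z n t)).
  { intros n. unfold Li_term, q. rewrite !powerRZ_O, !Cscal_RtoC, RtoC_1.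
    rewrite (S_INR (S n)), RtoC_plus, RtoC_1.
    transitivity (Cmul Cone (Cmul (Cexp (Cmul (RtoC t) z)) (Cexp (Cmul (RtoC t) (Cmul (RtoC (INR (S n))) z))))).
    - rewrite <- Cexp_add. do 2 f_equal. ring.
    - ring. }
  assert (R1 : Li_term 0 z 0 t = q).
  { unfold Li_term, q. rewrite powerRZ_O. change (INR 1) with 1. 
    replace (Cscal 1 z) with z by cc. cc. }
  assert (A1 : Series (fun n => fst (Li_term 0 z n t)) = fst q +
     (fst q * Series (fun n => fst (Li_term 0 z n t)) - snd q * Series (fun n => snd (Li_term 0 z n t)))).
  { rewrite Series_incr_1 at 1 by assumption. rewrite R1. f_equal.
    rewrite <- !Series_scal_l, <- Series_minus by (apply ex_series_Rscal; assumption).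
    apply Series_ext. intros n. rewrite R0. reflexivity. }
  assert (A2 : Series (fun n => snd (Li_term 0 z n t)) = snd q +
     (fst q * Series (fun n => snd (Li_term 0 z n t)) + snd q * Series (fun n => fst (Li_term 0 z n t)))).
  { rewrite Series_incr_1 at 1 by assumption. rewrite R1. f_equal.
    rewrite <- !Series_scal_l, <- Series_plus by (apply ex_series_Rscal; assumption).
    apply Series_ext. intros n. rewrite R0. reflexivity. }
  revert A1 A2. generalize (Series (fun n => fst (Li_term 0 z n t))) (Series (fun n => snd (Li_term 0 z n t))).
  clear R0 R1. clearbody q. intros a b A1 A2. apply CC_eq; simpl; nra.
Qed.

(** * Limits of polylogarithms at the two ends of a ray *)

Definition Clim_seq (u : nat -> CC) (l : CC) : Prop :=
  is_lim_seq (fun k => fst (u k)) (fst l) /\ is_lim_seq (fun k => snd (u k)) (snd l).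

Lemma Clim_seq_unique u l l' : Clim_seq u l -> Clim_seq u l' -> l = l'.
Proof.
  intros [A1 A2] [B1 B2]. apply is_lim_seq_unique in A1, A2, B1, B2.
  apply CC_eq; congruence.
Qed.

Lemma Clim_seq_const c : Clim_seq (fun _ => c) c.
Proof. split; apply is_lim_seq_const. Qed.

Lemma Clim_seq_ext u v l : (forall k, u k = v k) -> Clim_seq u l -> Clim_seq v l.
Proof.
  intros E [H1 H2]. split; (eapply is_lim_seq_ext; [|eassumption]); intros k; cbn beta; now rewrite E.
Qed.

Lemma Clim_seq_add u v l m : Clim_seq u l -> Clim_seq v m -> Clim_seq (fun k => Cadd (u k) (v k)) (Cadd l m).
Proof. intros [] []. split; now apply is_lim_seq_plus'. Qed.

Lemma Clim_seq_mul u v l m : Clim_seq u l -> Clim_seq v m -> Clim_seq (fun k => Cmul (u k) (v k)) (Cmul l m).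
Proof.
  intros [] []. split.
  - apply is_lim_seq_minus'; now apply is_lim_seq_mult'.
  - apply is_lim_seq_plus'; now apply is_lim_seq_mult'.
Qed.

Lemma Clim_seq_RtoC (u : nat -> R) (l : R) : is_lim_seq u l -> Clim_seq (fun k => RtoC (u k)) (RtoC l).
Proof. intros H. split; [exact H|apply is_lim_seq_const]. Qed.

Lemma Clim_seq_exp u l : Clim_seq u l -> Clim_seq (fun k => Cexp (u k)) (Cexp l).
Proof.
  intros [H1 H2]. split; apply is_lim_seq_mult';
    try (apply (is_lim_seq_continuous exp); [apply derivable_continuous_pt, derivable_pt_exp|assumption]).
  - apply (is_lim_seq_continuous cos); [apply continuity_cos|assumption].
  - apply (is_lim_seq_continuous sin); [apply continuity_sin|assumption].
Qed.

Lemma Clim_seq_norm0 u (b : nat -> R) : (forall k, Cnorm (u k) <= b k) -> is_lim_seq b 0 -> Clim_seq u Czero.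
Proof.
  intros Hu Hb.
  assert (Hb' : is_lim_seq (fun k => - b k) 0).
  { replace (Finite 0) with (Rbar_opp 0) by (simpl; f_equal; ring). now apply is_lim_seq_opp in Hb. }
  split; (apply is_lim_seq_le_le with (u := fun k => - b k) (w := b); [|assumption|assumption]);
   intros k; apply Rabs_le_between; (eapply Rle_trans; [|apply Hu]); [apply Cnorm_fst|apply Cnorm_snd].
Qed.

Lemma Li_dominated s z (tk : nat -> R) (b : nat -> R) (l : nat -> CC) :
  Cre z < 0 -> (forall k, 0 < tk k) ->
  (forall k n, Cnorm (Li_term (- s) z n (tk k)) <= b n) -> ex_series b ->
  (forall n, Clim_seq (fun k => Li_term (- s) z n (tk k)) (l n)) ->
  Clim_seq (fun k => Li s (Cexp (Cscal (tk k) z))) (Series (fun n => fst (l n)), Series (fun n => snd (l n))).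
Proof.
  intros Hz Ht Hb Sb Hl.
  eapply Clim_seq_ext; [intros k; symmetry; apply Li_eq; auto|].
  split; cbn [fst snd].
  - apply (Series_dominated (fun k n => fst (Li_term (- s) z n (tk k))) _ b); [|assumption|].
    + intros k n. eapply Rle_trans; [apply Cnorm_fst|apply Hb].
    + intros n. apply (Hl n).
  - apply (Series_dominated (fun k n => snd (Li_term (- s) z n (tk k))) _ b); [|assumption|].
    + intros k n. eapply Rle_trans; [apply Cnorm_snd|apply Hb].
    + intros n. apply (Hl n).
Qed.

Lemma Clim_seq_line (tk : nat -> R) (t : R) z : is_lim_seq tk t -> Clim_seq (fun k => Cscal (tk k) z) (Cscal t z).
Proof. intros H. split; simpl; apply is_lim_seq_mult'; try apply is_lim_seq_const; assumption. Qed.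

(** As [t] tends to 0 the exponentials give no uniform decay; the domination comes from [1 / n^2]
    alone. *)
Lemma Li2_lim z : Cre z < 0 ->
  Clim_seq (fun k => Li 2 (Cexp (Cscal (/ INR (S k)) z))) (RtoC Li2_one).
Proof.
  intros Hz.
  replace (RtoC Li2_one) with (Series (fun n => fst (RtoC (/ INR (S n) ^ 2))), Series (fun n => snd (RtoC (/ INR (S n) ^ 2)))).
  - apply (Li_dominated 2 z (fun k => / INR (S k)) (fun n => / INR (S n) ^ 2)
      (fun n => RtoC (/ INR (S n) ^ 2))); [assumption| | | |].
    + intros k. apply Rinv_0_lt_compat, lt_0_INR; lia.
    + intros k n. unfold Li_term. rewrite Cnorm_scal, Cnorm_Cexp. cbn [fst Cscal].
      assert (H1 : 0 < INR (S n)) by (apply lt_0_INR; lia).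
      assert (H2 : 0 < / INR (S k)) by (apply Rinv_0_lt_compat, lt_0_INR; lia).
      change (powerRZ (INR (S n)) (- (2))) with (/ INR (S n) ^ 2).
      assert (H3 : 0 < / INR (S n) ^ 2) by (apply Rinv_0_lt_compat, pow_lt; assumption).
      rewrite Rabs_pos_eq by lra. rewrite <- (Rmult_1_r (/ INR (S n) ^ 2)) at 2.
      apply Rmult_le_compat_l; [lra|].
      unfold Cre in Hz. left. apply exp_neg_lt1. assert (INR (S n) * fst z < 0) by nra. nra.
    + exists (PI ^ 2 / 6). apply basel.
    + intros n. unfold Li_term. change (powerRZ (INR (S n)) (- (2))) with (/ INR (S n) ^ 2).
      replace (RtoC (/ INR (S n) ^ 2)) with (Cmul (RtoC (/ INR (S n) ^ 2)) (Cexp (Cscal 0 (Cscal (INR (S n)) z)))).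
      * eapply Clim_seq_ext; [intros k; symmetry; apply Cscal_RtoC|].
        apply Clim_seq_mul; [apply Clim_seq_const|].
        apply Clim_seq_exp, Clim_seq_line, is_lim_inv_S.
      * replace (Cscal 0 (Cscal (INR (S n)) z)) with Czero by cc. rewrite Cexp_0. ring.
  - apply CC_eq; cbn [fst snd RtoC].
    + apply is_series_unique, basel.
    + apply Series_zero.
Qed.

Lemma is_lim_exp_neg c : c < 0 -> is_lim_seq (fun k => exp (INR (S k) * c)) 0.
Proof.
  intros Hc. apply (is_lim_seq_ext (fun k => exp c ^ S k)).
  - intros k. rewrite <- exp_mult_INR. f_equal; ring.
  - apply (is_lim_seq_incr_1 (fun k => exp c ^ k)).
    apply is_lim_seq_geom. destruct (exp_neg_lt1 c Hc). rewrite Rabs_pos_eq; lra.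
Qed.

(** At the other end of the ray all parameters are at least 1, and the geometric bound at [t0 = 1]
    dominates. This limit determines [exp kappa]. *)
Lemma Li1_lim z : Cre z < 0 ->
  Clim_seq (fun k => Li 1 (Cexp (Cscal (INR (S k)) z))) Czero.
Proof.
  intros Hz.
  assert (H1 : forall k, 1 <= INR (S k)) by (intros k; rewrite S_INR; generalize (pos_INR k); lra).
  replace Czero with (Series (fun n : nat => fst Czero), Series (fun n : nat => snd Czero)).
  - apply (Li_dominated 1 z (fun k => INR (S k)) (fun n => INR (S n) ^ Z.to_nat (- (1)) * exp (1 * Cre z) ^ S n)
      (fun n => Czero)); [assumption| | | |].
    + intros k. generalize (H1 k); lra.
    + intros k n. apply Cnorm_Li_term; [assumption|]. generalize (H1 k); lra.
    + apply ex_series_Li_bound; lra.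
    + intros n. apply Clim_seq_norm0 with (fun k => INR (S n) ^ Z.to_nat (- (1)) * exp (INR (S k) * (INR (S n) * Cre z))).
      * intros k. eapply Rle_trans; [apply (Cnorm_Li_term _ z n _ (INR (S k)))|]; [assumption|generalize (H1 k); lra|].
        right. f_equal. rewrite <- exp_mult_INR. f_equal; ring.
      * replace (Finite 0) with (Finite (INR (S n) ^ Z.to_nat (- (1)) * 0)) by (f_equal; ring).
        apply is_lim_seq_mult'; [apply is_lim_seq_const|]. apply is_lim_exp_neg.
        generalize (H1 n). nra.
  - apply CC_eq; apply Series_zero.
Qed.

(** * The logarithm of (exp (tz) - 1) / (tz) *)

Definition Fcoef (j : nat) (z : CC) (n : nat) : CC := Cscal (/ INR (fact (n + j))) (Cpow z n).

(** [Fser 1 z t = (exp (t z) - 1) / (t z)]; the family is closed under [d/dt]. *)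
Definition Fser (j : nat) (z : CC) (t : R) : CC :=
  (PSeries (fun n => fst (Fcoef j z n)) t, PSeries (fun n => snd (Fcoef j z n)) t).

Lemma Cnorm_Cpow z n : Cnorm (Cpow z n) = Cnorm z ^ n.
Proof.
  induction n as [|n IH]; simpl.
  - change Cone with (RtoC 1). rewrite Cnorm_RtoC. apply Rabs_R1.
  - now rewrite Cnorm_mult, IH.
Qed.

Lemma Cnorm_Fcoef j z n : Cnorm (Fcoef j z n) <= / INR (fact n) * Cnorm z ^ n.
Proof.
  unfold Fcoef. rewrite Cnorm_scal, Cnorm_Cpow.
  assert (0 < INR (fact n)) by (apply lt_0_INR, lt_O_fact).
  assert (INR (fact n) <= INR (fact (n + j))) by (apply le_INR, fact_le; lia).
  rewrite Rabs_pos_eq by (left; apply Rinv_0_lt_compat; lra).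
  apply Rmult_le_compat_r; [apply pow_le, Cnorm_nonneg|]. apply Rinv_le_contravar; lra.
Qed.

Lemma is_series_exp x : is_series (fun n => / INR (fact n) * x ^ n) (exp x).
Proof.
  generalize (is_exp_Reals x). intros H. apply is_pseries_R in H. exact H.
Qed.

Lemma Fcoef_bound j z n t :
  Rabs (fst (Fcoef j z n) * t ^ n) <= / INR (fact n) * (Cnorm z * Rabs t) ^ n /\
  Rabs (snd (Fcoef j z n) * t ^ n) <= / INR (fact n) * (Cnorm z * Rabs t) ^ n.
Proof.
  rewrite !Rabs_mult, <- RPow_abs, Rpow_mult_distr, <- Rmult_assoc.
  split; (apply Rmult_le_compat_r; [apply pow_le, Rabs_pos|]);
   (eapply Rle_trans; [|apply (Cnorm_Fcoef j)]); [apply Cnorm_fst|apply Cnorm_snd].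
Qed.

Lemma ex_series_Fser j z t :
  ex_series (fun n => fst (Fcoef j z n) * t ^ n) /\ ex_series (fun n => snd (Fcoef j z n) * t ^ n).
Proof.
  split; (eapply ex_series_abs_le; [intros n; apply (Fcoef_bound j z n t)|]);
   (eexists; apply is_series_exp).
Qed.

Lemma Cnorm_Fser j z t : Cnorm (Fser j z t) <= 2 * exp (Cnorm z * Rabs t).
Proof.
  eapply Rle_trans; [apply Cnorm_le_sum|].
  assert (E := is_series_exp (Cnorm z * Rabs t)).
  rewrite <- (is_series_unique _ _ E).
  assert (ex_series (fun n => / INR (fact n) * (Cnorm z * Rabs t) ^ n)) by (eexists; exact E).
  unfold Fser, PSeries; cbn [fst snd].
  generalize (Series_abs_le _ _ (fun n => proj1 (Fcoef_bound j z n t)) H)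
    (Series_abs_le _ _ (fun n => proj2 (Fcoef_bound j z n t)) H). lra.
Qed.

Lemma CV_radius_entire (a : nat -> R) x :
  (forall r, ex_series (fun n => Rabs (a n * r ^ n))) -> Rbar_lt (Rabs x) (CV_radius a).
Proof.
  intros H. destruct (Lub_Rbar_correct (CV_disk a)) as [U _].
  apply Rbar_lt_le_trans with (Rabs x + 1); [simpl; lra|].
  apply U. apply H.
Qed.

Lemma Fser_shift j z t :
  Fser j z t = Cadd (RtoC (/ INR (fact j))) (Cmul (Cscal t z) (Fser (S j) z t)).
Proof.
  destruct (ex_series_Fser j z t) as [E1 E2]. destruct (ex_series_Fser (S j) z t) as [E3 E4].
  assert (Ec : forall n, Fcoef j z (S n) = Cmul z (Fcoef (S j) z n)).
  { intros n. unfold Fcoef. replace (n + S j)%nat with (S n + j)%nat by lia.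
    rewrite !Cscal_RtoC. cbn [Cpow]. ring. }
  unfold Fser, PSeries. apply CC_eq; cbn [fst snd Cadd Cmul RtoC Cscal].
  - rewrite Series_incr_1 by assumption. f_equal.
    + unfold Fcoef; simpl. ring.
    + rewrite <- !Series_scal_l, <- Series_minus by (apply ex_series_Rscal; assumption).
      apply Series_ext. intros n. rewrite Ec. simpl. ring.
  - rewrite Series_incr_1 by assumption. f_equal.
    + unfold Fcoef; simpl. ring.
    + rewrite <- !Series_scal_l, <- Series_plus by (apply ex_series_Rscal; assumption).
      apply Series_ext. intros n. rewrite Ec. simpl. ring.
Qed.

(** Write [n = (n + j) - j] in front of the coefficient [z^n / (n+j)!]: the first part lowers the
    factorial, the second keeps it. *)
Lemma cderiv_Fser j z t :
  cderiv (Fser j z) t (Cmul z (Csub (Fser j z t) (Cscal (INR j) (Fser (S j) z t)))).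
Proof.
  assert (Hr : forall j (p : CC -> R), (forall w, Rabs (p w) <= Cnorm w) ->
     Rbar_lt (Rabs t) (CV_radius (fun n => p (Fcoef j z n)))).
  { intros i p Hp. apply CV_radius_entire. intros r.
    apply (ex_series_abs_le _ (fun n => / INR (fact n) * (Cnorm z * Rabs r) ^ n)).
    - intros n. rewrite Rabs_Rabsolu, Rabs_mult, <- RPow_abs, Rpow_mult_distr, <- Rmult_assoc.
      apply Rmult_le_compat_r; [apply pow_le, Rabs_pos|].
      eapply Rle_trans; [apply Hp|]. apply (Cnorm_Fcoef i).
    - eexists; apply is_series_exp. }
  assert (Ec : forall n, Cscal (INR (S n)) (Fcoef j z (S n)) =
     Cmul z (Csub (Fcoef j z n) (Cscal (INR j) (Fcoef (S j) z n)))).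
  { intros n. unfold Fcoef. replace (n + S j)%nat with (S (n + j)) by lia.
    change (S n + j)%nat with (S (n + j)). rewrite (fact_simpl (n + j)), mult_INR.
    rewrite !Cscal_RtoC. cbn [Cpow].
    assert (Hs : INR (S (n + j)) <> 0) by (apply not_0_INR; lia).
    assert (Hf := INR_fact_neq_0 (n + j)).
    transitivity (Cmul (RtoC (INR (S n) * / (INR (S (n + j)) * INR (fact (n + j))))) (Cmul z (Cpow z n)));
      [rewrite RtoC_mult; ring|].
    transitivity (Cmul (RtoC (/ INR (fact (n + j)) - INR j * / (INR (S (n + j)) * INR (fact (n + j))))) (Cmul z (Cpow z n)));
      [|unfold Rminus; rewrite RtoC_plus, RtoC_opp, RtoC_mult; ring].
    do 2 f_equal. replace (INR (S n)) with (INR (S (n + j)) - INR j) by (rewrite !S_INR, plus_INR; ring).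
    field. now split. }
  destruct (ex_series_Fser j z t) as [E1 E2]. destruct (ex_series_Fser (S j) z t) as [E3 E4].
  assert (Ex : forall (a b : nat -> R) c, ex_series a -> ex_series b -> ex_series (fun n => a n - c * b n)).
  { intros a b c Ha Hb. apply (ex_series_minus (V := R_NormedModule)); [assumption|].
    now apply ex_series_Rscal. }
  split.
  - eapply is_derive_eq; [apply is_derive_PSeries; apply (Hr j fst Cnorm_fst)|].
    unfold PSeries, PS_derive, Fser; cbn [fst snd Cmul Csub Cadd Copp Cscal].
    transitivity (fst z * (Series (fun n => fst (Fcoef j z n) * t ^ n - INR j * (fst (Fcoef (S j) z n) * t ^ n)))
      - snd z * (Series (fun n => snd (Fcoef j z n) * t ^ n - INR j * (snd (Fcoef (S j) z n) * t ^ n)))).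
    + rewrite <- !Series_scal_l, <- Series_minus by (apply ex_series_Rscal, Ex; assumption).
      apply Series_ext. intros n.
      assert (Ef := f_equal fst (Ec n)). cbn [fst snd Cmul Csub Cadd Copp Cscal] in Ef.
      rewrite Ef. ring.
    + rewrite !Series_minus, !Series_scal_l; try assumption; try (apply ex_series_Rscal; assumption).
      unfold PSeries. ring.
  - eapply is_derive_eq; [apply is_derive_PSeries; apply (Hr j snd Cnorm_snd)|].
    unfold PSeries, PS_derive, Fser; cbn [fst snd Cmul Csub Cadd Copp Cscal].
    transitivity (fst z * (Series (fun n => snd (Fcoef j z n) * t ^ n - INR j * (snd (Fcoef (S j) z n) * t ^ n)))
      + snd z * (Series (fun n => fst (Fcoef j z n) * t ^ n - INR j * (fst (Fcoef (S j) z n) * t ^ n)))).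
    + rewrite <- !Series_scal_l, <- Series_plus by (apply ex_series_Rscal, Ex; assumption).
      apply Series_ext. intros n.
      assert (Ef := f_equal snd (Ec n)). cbn [fst snd Cmul Csub Cadd Copp Cscal] in Ef.
      rewrite Ef. ring.
    + rewrite !Series_minus, !Series_scal_l; try assumption; try (apply ex_series_Rscal; assumption).
      unfold PSeries. ring.
Qed.

Lemma Fser_at_0 j z : Fser j z 0 = RtoC (/ INR (fact j)).
Proof. rewrite Fser_shift. cc. Qed.

Lemma Fser2_eq z t : Cmul (Cscal t z) (Fser 2 z t) = Csub (Fser 1 z t) Cone.
Proof.
  rewrite (Fser_shift 1). change (INR (fact 1)) with 1. rewrite Rinv_1, RtoC_1. ring.
Qed.

(** [y = 1 + t z Fser 1 z t] solves [y' = z y], [y 0 = 1]. *)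
Lemma Fser1_eq z t : Cmul (Cscal t z) (Fser 1 z t) = Csub (Cexp (Cscal t z)) Cone.
Proof.
  set (y := fun s => Cadd Cone (Cmul (Cscal s z) (Fser 1 z s))).
  set (u := fun s => Cmul (y s) (Cexp (Copp (Cscal s z)))).
  assert (Dy : forall s, cderiv y s (Cmul z (y s))).
  { intros s. eapply cderiv_eq.
    - apply cderiv_add; [apply cderiv_const|]. apply cderiv_mul; [apply cderiv_line|apply cderiv_Fser].
    - unfold y. change (INR 1) with 1. replace (Cscal 1 (Fser 2 z s)) with (Fser 2 z s) by cc.
      transitivity (Cadd (Cmul z (Fser 1 z s)) (Cmul z (Csub (Cmul (Cscal s z) (Fser 1 z s))
         (Cmul (Cscal s z) (Fser 2 z s))))); [ring|].
      rewrite Fser2_eq. ring. }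
  assert (Du : forall s, cderiv u s Czero).
  { intros s. eapply cderiv_eq.
    - apply cderiv_mul; [apply Dy|]. apply cderiv_Cexp, cderiv_opp, cderiv_line.
    - cbn beta. ring. }
  assert (U : u t = u 0).
  { destruct (Rle_lt_dec 0 t); [symmetry|]; apply cderiv_zero_const; intros; auto; lra. }
  assert (U0 : u 0 = Cone).
  { unfold u, y. replace (Cscal 0 z) with Czero by cc. replace (Copp Czero) with Czero by ring.
    rewrite Cexp_0. ring. }
  rewrite U0 in U. unfold u in U. rewrite Cexp_opp in U.
  assert (Hn := Cexp_neq (Cscal t z)).
  assert (Ey : y t = Cexp (Cscal t z)).
  { replace (y t) with (Cmul (Cmul (y t) (Cinv (Cexp (Cscal t z)))) (Cexp (Cscal t z))) by (field; assumption).
    rewrite U. ring. }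
  rewrite <- Ey. unfold y. ring.
Qed.

Lemma Cexp_line_neq1 z t : Cre z < 0 -> t <> 0 -> Csub Cone (Cexp (Cscal t z)) <> Czero.
Proof.
  intros Hz Ht E.
  assert (E1 : Cexp (Cscal t z) = RtoC 1).
  { rewrite RtoC_1. replace (Cexp (Cscal t z)) with (Csub Cone (Csub Cone (Cexp (Cscal t z)))) by ring.
    rewrite E. ring. }
  apply (f_equal Cnorm) in E1. rewrite Cnorm_Cexp, Cnorm_RtoC, Rabs_R1, <- exp_0 in E1.
  apply exp_inv in E1. cbn [fst Cscal] in E1. unfold Cre in Hz.
  apply Rmult_integral in E1. lra.
Qed.

Lemma Fser1_neq z t : Cre z < 0 -> Fser 1 z t <> Czero.
Proof.
  intros Hz E. destruct (Req_dec t 0) as [->|Ht].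
  - rewrite Fser_at_0 in E. revert E. apply RtoC_neq. simpl. lra.
  - apply (Cexp_line_neq1 z t Hz Ht).
    replace (Csub Cone (Cexp (Cscal t z))) with (Copp (Csub (Cexp (Cscal t z)) Cone)) by ring.
    rewrite <- Fser1_eq, E. ring.
Qed.

Lemma Cnorm_Cone_sub w : 1 - Cnorm w <= Cnorm (Csub Cone w).
Proof.
  generalize (Cnorm_triang (Csub Cone w) w). replace (Cadd (Csub Cone w) w) with (RtoC 1) by (rewrite RtoC_1; ring).
  rewrite Cnorm_RtoC, Rabs_R1. lra.
Qed.

(** For [t > 0], [|exp (t z) - 1| >= 1 - exp (- t delta) >= t delta exp (- delta)], while
    [|t z| <= t C]; the factor [t] cancels, so the bound does not degenerate near 0. At [t = 0] the
    value is 1 and [delta <= C] suffices. *)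
Lemma Fser1_inv_bound delta C z t :
  0 < delta -> Cre z <= - delta -> Cnorm z <= C -> 0 <= t <= 1 ->
  Cnorm (Cinv (Fser 1 z t)) <= C * exp delta / delta.
Proof.
  intros Hd Hz HC Ht.
  assert (Hn : Fser 1 z t <> Czero) by (apply Fser1_neq; lra).
  assert (EI : Cnorm (Cinv (Fser 1 z t)) * Cnorm (Fser 1 z t) = 1).
  { rewrite <- Cnorm_mult. replace (Cmul (Cinv (Fser 1 z t)) (Fser 1 z t)) with (RtoC 1) by (rewrite RtoC_1; field; assumption).
    rewrite Cnorm_RtoC. apply Rabs_R1. }
  assert (Hed := exp_ineq1 delta ltac:(lra)).
  assert (HdC : delta <= C).
  { unfold Cre in Hz. generalize (Cnorm_fst z). unfold Rabs. destruct (Rcase_abs (fst z)); lra. }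
  assert (LB : delta <= Cnorm (Fser 1 z t) * (C * exp delta)).
  { destruct (Req_dec t 0) as [->|Ht0].
    - rewrite Fser_at_0, Cnorm_RtoC. change (INR (fact 1)) with 1. rewrite Rinv_1, Rabs_R1. nra.
    - assert (N1 : Cnorm (Cscal t z) * Cnorm (Fser 1 z t) >= 1 - exp (t * - delta)).
      { rewrite <- Cnorm_mult, Fser1_eq.
        replace (Csub (Cexp (Cscal t z)) Cone) with (Copp (Csub Cone (Cexp (Cscal t z)))) by ring.
        rewrite Cnorm_opp. apply Rle_ge. eapply Rle_trans; [|apply Cnorm_Cone_sub].
        rewrite Cnorm_Cexp. cbn [fst Cscal]. unfold Cre in Hz.
        assert (E : t * fst z <= t * - delta) by nra.
        destruct E as [E|E]; [apply exp_increasing in E; lra|rewrite E; lra]. }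
      rewrite Cnorm_scal, Rabs_pos_eq in N1 by lra.
      assert (N2 : 1 - exp (t * - delta) >= t * delta * exp (- delta)).
      { assert (e1 : exp (t * - delta) * exp (t * delta) = 1) by (rewrite <- exp_plus, <- exp_0; f_equal; ring).
        assert (e2 : 1 + t * delta < exp (t * delta)) by (apply exp_ineq1; nra).
        assert (e3 : exp (- delta) <= exp (t * - delta)).
        { destruct (Req_dec t 1) as [->|]; [right; f_equal; ring|]. left. apply exp_increasing. nra. }
        assert (e4 := exp_pos (t * - delta)). assert (0 < t * delta) by nra. nra. }
      assert (e1 : exp (- delta) * exp delta = 1) by (rewrite <- exp_plus, <- exp_0; f_equal; ring).
      assert (e2 := exp_pos delta).
      assert (N3 : Cnorm z * Cnorm (Fser 1 z t) >= delta * exp (- delta)).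
      { apply Rle_ge, Rmult_le_reg_l with t; [lra|]. nra. }
      assert (N4 : Cnorm z * Cnorm (Fser 1 z t) <= C * Cnorm (Fser 1 z t)).
      { apply Rmult_le_compat_r; [apply Cnorm_nonneg|assumption]. }
      replace delta with (delta * exp (- delta) * exp delta) by (rewrite Rmult_assoc, e1; ring).
      (* The preceding rewriting has also replaced the [delta] inside [exp]; this restores it. *)
      replace (Cnorm (Fser 1 z t) * (C * exp (delta * exp (- delta) * exp delta)))
        with (C * Cnorm (Fser 1 z t) * exp delta).
      + apply Rmult_le_compat_r; lra.
      + replace (delta * exp (- delta) * exp delta) with delta by (rewrite Rmult_assoc, e1; ring). ring. }
  apply Rmult_le_reg_r with delta; [assumption|].
  replace (C * exp delta / delta * delta) with (C * exp delta) by (field; lra).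
  assert (0 <= Cnorm (Cinv (Fser 1 z t))) by apply Cnorm_nonneg.
  apply Rle_trans with (Cnorm (Cinv (Fser 1 z t)) * (Cnorm (Fser 1 z t) * (C * exp delta))).
  - apply Rmult_le_compat_l; assumption.
  - rewrite <- Rmult_assoc, EI. lra.
Qed.

(** Terms closed under [d/dt]: all derivatives of [Fser' / Fser] are obtained, and bounded
    uniformly in [z], by induction on them. *)
Inductive dexpr : Type :=
| EZ | EF (j : nat) | EInv
| EScal (r : R) (e : dexpr) | EAdd (e1 e2 : dexpr) | EMul (e1 e2 : dexpr).

Fixpoint deval (e : dexpr) (z : CC) (t : R) : CC :=
  match e with
  | EZ => z
  | EF j => Fser j z t
  | EInv => Cinv (Fser 1 z t)
  | EScal r e => Cmul (RtoC r) (deval e z t)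
  | EAdd e1 e2 => Cadd (deval e1 z t) (deval e2 z t)
  | EMul e1 e2 => Cmul (deval e1 z t) (deval e2 z t)
  end.

Definition dF (j : nat) : dexpr := EMul EZ (EAdd (EF j) (EScal (- INR j) (EF (S j)))).

Fixpoint dD (e : dexpr) : dexpr :=
  match e with
  | EZ => EScal 0 EZ
  | EF j => dF j
  | EInv => EScal (-1) (EMul (EMul EInv EInv) (dF 1))
  | EScal r e => EScal r (dD e)
  | EAdd e1 e2 => EAdd (dD e1) (dD e2)
  | EMul e1 e2 => EAdd (EMul (dD e1) e2) (EMul e1 (dD e2))
  end.

Lemma cderiv_dF j z t : cderiv (Fser j z) t (deval (dF j) z t).
Proof.
  eapply cderiv_eq; [apply cderiv_Fser|]. cbn [deval dF].
  rewrite Cscal_RtoC, RtoC_opp. ring.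
Qed.

Lemma cderiv_deval e z t : Cre z < 0 -> cderiv (deval e z) t (deval (dD e) z t).
Proof.
  intros Hz. induction e as [|j| |r e IH|e1 IH1 e2 IH2|e1 IH1 e2 IH2]; cbn [deval dD].
  - eapply cderiv_eq; [apply cderiv_const|]. cc.
  - apply cderiv_dF.
  - eapply cderiv_eq; [apply cderiv_inv; [now apply Fser1_neq|apply cderiv_dF]|].
    cbn [deval dF]. replace (RtoC (-1)) with (Copp Cone) by cc. ring.
  - now apply cderiv_cmul.
  - now apply cderiv_add.
  - now apply cderiv_mul.
Qed.

Lemma deval_bound e delta C : 0 < delta ->
  exists M, forall z t, Cre z <= - delta -> Cnorm z <= C -> 0 <= t <= 1 -> Cnorm (deval e z t) <= M.
Proof.
  intros Hd. induction e as [|j| |r e [M IH]|e1 [M1 IH1] e2 [M2 IH2]|e1 [M1 IH1] e2 [M2 IH2]]; cbn [deval].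
  - now exists C.
  - exists (2 * exp C). intros z t _ HC Ht. eapply Rle_trans; [apply Cnorm_Fser|].
    rewrite Rabs_pos_eq by lra.
    assert (E : Cnorm z * t <= C) by (generalize (Cnorm_nonneg z); nra).
    destruct E as [E|E]; [apply exp_increasing in E; lra|rewrite E; lra].
  - exists (C * exp delta / delta). intros. now apply Fser1_inv_bound.
  - exists (Rabs r * M). intros z t Hz HC Ht. rewrite Cnorm_mult, Cnorm_RtoC.
    apply Rmult_le_compat_l; [apply Rabs_pos|auto].
  - exists (M1 + M2). intros z t Hz HC Ht. eapply Rle_trans; [apply Cnorm_triang|].
    apply Rplus_le_compat; auto.
  - exists (M1 * M2). intros z t Hz HC Ht. rewrite Cnorm_mult.
    apply Rmult_le_compat; try apply Cnorm_nonneg; auto.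
Qed.

(** The logarithmic derivative of [Fser 1], whose derivative is [z (Fser 1 - Fser 2)] by
    [cderiv_Fser]. *)
Definition glog_expr : dexpr := EMul EZ (EMul (EAdd (EF 1) (EScal (-1) (EF 2))) EInv).

Definition CRInt (f : R -> CC) (t : R) : CC :=
  (RInt (fun s => fst (f s)) 0 t, RInt (fun s => snd (f s)) 0 t).

(** [glog z 1] is the logarithm of [Fser 1 z] vanishing at [0]; the index counts
    derivatives of its primitive [glog z 0], as Euler-Maclaurin requires. *)
Definition glog (z : CC) (n : nat) : R -> CC :=
  match n with
  | O => CRInt (CRInt (deval glog_expr z))
  | S O => CRInt (deval glog_expr z)
  | S (S n) => deval (Nat.iter n dD glog_expr) z
  end.

Lemma cderiv_CRInt f t : (forall s, exists l, cderiv f s l) -> cderiv (CRInt f) t (f t).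
Proof.
  intros Hf.
  assert (C1 : forall s, continuous (fun s => fst (f s)) s).
  { intros s. destruct (Hf s) as [l [H1 H2]]. apply (ex_derive_continuous (V := R_NormedModule)). eexists; exact H1. }
  assert (C2 : forall s, continuous (fun s => snd (f s)) s).
  { intros s. destruct (Hf s) as [l [H1 H2]]. apply (ex_derive_continuous (V := R_NormedModule)). eexists; exact H2. }
  split; unfold CRInt; cbn [fst snd].
  - apply (is_derive_RInt (fun s => fst (f s)) (fun b => RInt (fun s => fst (f s)) 0 b) 0 t); [|apply C1].
    apply filter_forall. intros b. apply (RInt_correct (V := R_CompleteNormedModule)).
    apply (ex_RInt_continuous (V := R_CompleteNormedModule)). intros; apply C1.
  - apply (is_derive_RInt (fun s => snd (f s)) (fun b => RInt (fun s => snd (f s)) 0 b) 0 t); [|apply C2].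
    apply filter_forall. intros b. apply (RInt_correct (V := R_CompleteNormedModule)).
    apply (ex_RInt_continuous (V := R_CompleteNormedModule)). intros; apply C2.
Qed.

Lemma cderiv_glog z n t : Cre z < 0 -> cderiv (glog z n) t (glog z (S n) t).
Proof.
  intros Hz. destruct n as [|[|n]]; cbn [glog].
  - apply cderiv_CRInt. intros s. eexists. apply cderiv_CRInt. intros x. eexists. now apply cderiv_deval.
  - apply cderiv_CRInt. intros x. eexists. now apply cderiv_deval.
  - simpl Nat.iter. now apply cderiv_deval.
Qed.

Lemma CRInt_at_0 f : CRInt f 0 = Czero.
Proof. unfold CRInt. now rewrite !RInt_point. Qed.

Lemma Cre_neg_neq z : Cre z < 0 -> z <> Czero.
Proof. intros Hz ->. unfold Cre in Hz; simpl in Hz. lra. Qed.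

Lemma Csub_neq_sym a b : Csub a b <> Czero -> Csub b a <> Czero.
Proof.
  intros H E. apply H. replace (Csub a b) with (Copp (Csub b a)) by ring. rewrite E. ring.
Qed.

Lemma Clim_seq_eq u l l' : Clim_seq u l -> l = l' -> Clim_seq u l'.
Proof. now intros H <-. Qed.

Lemma glog_0_at_0 z : glog z 0 0 = Czero.
Proof. apply CRInt_at_0. Qed.

Lemma glog_1_at_0 z : glog z 1 0 = Czero.
Proof. apply CRInt_at_0. Qed.

Lemma glog_2_eq z t : glog z 2 t = Cmul z (Cmul (Csub (Fser 1 z t) (Fser 2 z t)) (Cinv (Fser 1 z t))).
Proof. cbn [glog Nat.iter glog_expr deval nat_rect]. replace (RtoC (-1)) with (Copp Cone) by cc. ring. Qed.

Lemma glog_2_at_0 z : glog z 2 0 = Cscal (/ 2) z.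
Proof.
  rewrite glog_2_eq, !Fser_at_0. change (INR (fact 1)) with 1. change (INR (fact 2)) with 2.
  apply CC_eq; simpl; field.
Qed.

(** The quotient of [Fser 1] by the exponential has derivative 0 and equals 1 at 0; the logarithm is
    thus obtained by integration, with its branch fixed by continuity. *)
Lemma Cexp_glog z t : Cre z < 0 -> Cexp (glog z 1 t) = Fser 1 z t.
Proof.
  intros Hz.
  set (v := fun s => Cmul (Cexp (Copp (glog z 1 s))) (Fser 1 z s)).
  assert (Dv : forall s, cderiv v s Czero).
  { intros s. assert (Hn := Fser1_neq z s Hz). eapply cderiv_eq.
    - apply cderiv_mul; [apply cderiv_Cexp, cderiv_opp, (cderiv_glog z 1 s Hz)|apply cderiv_Fser].
    - cbn beta. rewrite glog_2_eq. change (INR 1) with 1.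
      replace (Cscal 1 (Fser 2 z s)) with (Fser 2 z s) by cc. field. assumption. }
  assert (V : v t = v 0).
  { destruct (Rle_lt_dec 0 t); [symmetry|]; apply cderiv_zero_const; intros; auto; lra. }
  assert (V0 : v 0 = Cone).
  { unfold v. rewrite glog_1_at_0, Fser_at_0. replace (Copp Czero) with Czero by ring. rewrite Cexp_0.
    change (INR (fact 1)) with 1. rewrite Rinv_1, RtoC_1. ring. }
  rewrite V0 in V. unfold v in V. rewrite Cexp_opp in V.
  assert (Hn := Cexp_neq (glog z 1 t)).
  replace (Fser 1 z t) with (Cmul (Cmul (Cinv (Cexp (glog z 1 t))) (Fser 1 z t)) (Cexp (glog z 1 t))) by (field; assumption).
  rewrite V. ring.
Qed.

Lemma glog_2_off_0 z t : Cre z < 0 -> t <> 0 ->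
  glog z 2 t = Csub (Cdiv (Cmul z (Cexp (Cscal t z))) (Csub (Cexp (Cscal t z)) Cone)) (RtoC (/ t)).
Proof.
  intros Hz Ht. rewrite glog_2_eq.
  assert (Hq := Cexp_line_neq1 z t Hz Ht). assert (HF := Fser1_neq z t Hz).
  assert (Hz0 := Cre_neg_neq z Hz). assert (HT := RtoC_neq t Ht).
  assert (E1 := Fser1_eq z t). assert (E2 := Fser2_eq z t).
  rewrite Cscal_RtoC in *. rewrite RtoC_inv by assumption.
  revert Hq HF E1 E2. generalize (Cexp (Cmul (RtoC t) z)) (Fser 1 z t) (Fser 2 z t). intros q F1 F2 Hq HF E1 E2.
  assert (E2' : F2 = Cdiv (Csub F1 Cone) (Cmul (RtoC t) z)).
  { rewrite <- E2. field. now split. }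
  assert (Eq : q = Cadd (Cmul (Cmul (RtoC t) z) F1) Cone) by (rewrite E1; ring).
  rewrite E2', Eq. field. repeat split; try assumption. change (R1, R0) with Cone.
  replace (Csub (Cadd (Cmul (Cmul (RtoC t) z) F1) Cone) Cone) with (Cmul (Cmul (RtoC t) z) F1) by ring.
  apply Cmul_neq; [apply Cmul_neq|]; assumption.
Qed.

(** The case [n = 0] is the geometric series; each further case differentiates the previous
    identity, which holds in a neighbourhood of [t]. *)
Lemma glog_Li z n t : Cre z < 0 -> 0 < t ->
  glog z (S (S n)) t =
  Csub (Copp (Cmul (Cpow z (S n)) (Li (- Z.of_nat n) (Cexp (Cscal t z))))) (RtoC (ln_tower (S (S n)) t)).
Proof.
  intros Hz. revert t. induction n as [|n IH]; intros t Ht.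
  - rewrite glog_2_off_0 by (try assumption; lra). change (- Z.of_nat 0)%Z with 0%Z.
    assert (Hq := Cexp_line_neq1 z t Hz ltac:(lra)). assert (E := Li_0 z t Hz Ht).
    revert Hq E. generalize (Cexp (Cscal t z)) (Li 0 (Cexp (Cscal t z))). intros q l Hq E.
    replace l with (Cdiv (Cmul l (Csub Cone q)) (Csub Cone q)) by (field; assumption). rewrite E.
    replace (ln_tower 2 t) with (/ t) by (unfold ln_tower; simpl; field; lra). cbn [Cpow].
    assert (Hq' := Csub_neq_sym _ _ Hq). assert (HT := RtoC_neq t ltac:(lra)).
    rewrite RtoC_inv by lra. field. repeat split; assumption.
  - apply (cderiv_unique (glog z (S (S n))) t); [now apply cderiv_glog|].
    apply (cderiv_ext_loc (fun t => Csub (Copp (Cmul (Cpow z (S n)) (Li (- Z.of_nat n) (Cexp (Cscal t z))))) (RtoC (ln_tower (S (S n)) t)))).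
    { eapply filter_imp; [|apply (locally_pos t Ht)]. intros s Hs. symmetry. now apply IH. }
    eapply cderiv_eq.
    + apply cderiv_sub; [|apply cderiv_RtoC, is_derive_ln_tower, Ht].
      apply cderiv_opp, cderiv_cmul, cderiv_Li; assumption.
    + replace (- Z.of_nat n - 1)%Z with (- Z.of_nat (S n))%Z by lia. cbn [Cpow]. ring.
Qed.

(** With [q = exp (t z)], the sum of [q / (q - 1)] and the same expression in [1/q] is 1, and the
    terms in [1/t] cancel; further cases follow by differentiation. The quotient form is used
    because [- t] leaves the domain of the polylogarithm series. *)
Lemma glog_reflect z n t : Cre z < 0 ->
  Cadd (glog z (S (S n)) t) (Cmul (RtoC ((-1) ^ n)) (glog z (S (S n)) (- t))) =
  match n with O => z | S _ => Czero end.
Proof.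
  intros Hz. revert t. induction n as [|n IH]; intros t.
  - simpl pow. rewrite RtoC_1. destruct (Req_dec t 0) as [->|Ht].
    + rewrite Ropp_0, glog_2_at_0. apply CC_eq; simpl; field.
    + assert (Ht' : - t <> 0) by lra.
      rewrite !glog_2_off_0 by assumption.
      assert (Hq := Cexp_line_neq1 z t Hz Ht). assert (Hn := Cexp_neq (Cscal t z)).
      replace (Cscal (- t) z) with (Copp (Cscal t z)) by cc. rewrite Cexp_opp.
      replace (/ - t) with (- / t) by (field; assumption). rewrite RtoC_opp.
      assert (Hq2 : Csub (Cexp (Cscal t z)) Cone <> Czero).
      { now apply Csub_neq_sym. }
      revert Hq Hn Hq2. generalize (Cexp (Cscal t z)). intros q Hq Hn Hq2.
      field. now repeat split.
  - apply (cderiv_unique (fun t => Cadd (glog z (S (S n)) t) (Cmul (RtoC ((-1) ^ n)) (glog z (S (S n)) (- t)))) t).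
    + eapply cderiv_eq.
      * apply cderiv_add; [now apply cderiv_glog|]. apply cderiv_cmul, cderiv_reflect. now apply cderiv_glog.
      * replace ((-1) ^ S n) with (- (-1) ^ n) by (simpl; ring). rewrite RtoC_opp. ring.
    + destruct n as [|n].
      * apply (cderiv_ext (fun _ => z)); [intros s; now rewrite IH|apply cderiv_const].
      * apply (cderiv_ext (fun _ => Czero)); [intros s; now rewrite IH|apply cderiv_const].
Qed.

(** Index [2 m + 4] is the derivative of order [2 m + 2] of [g']; since [g' - z/2] is odd, its
    derivatives of even order vanish at 0. *)
Lemma glog_even_at_0 z m : Cre z < 0 -> glog z (2 * m + 4) 0 = Czero.
Proof.
  intros Hz. replace (2 * m + 4)%nat with (S (S (S (2 * m + 1)))) by lia.
  generalize (glog_reflect z (S (2 * m + 1)) 0 Hz).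
  replace (S (2 * m + 1)) with (2 * (m + 1))%nat by lia. rewrite pow_1_even, Ropp_0, RtoC_1.
  replace (2 * (m + 1))%nat with (S (2 * m + 1)) by lia.
  intros E. generalize (f_equal fst E) (f_equal snd E). simpl. intros. apply CC_eq; simpl; lra.
Qed.

(** The constant of integration between [g t] and [- Li 1 (exp (t z)) - ln t]; a logarithm of
    [- 1/z] whose branch is left open. *)
Definition kappa (z : CC) : CC := Cadd (glog z 1 1) (Li 1 (Cexp z)).

Lemma Cscal_1 z : Cscal 1 z = z.
Proof. cc. Qed.

Lemma glog_1_eq z t : Cre z < 0 -> 0 < t ->
  glog z 1 t = Csub (Csub (kappa z) (Li 1 (Cexp (Cscal t z)))) (RtoC (ln t)).
Proof.
  intros Hz Ht.
  set (u := fun s => Cadd (Cadd (glog z 1 s) (Li 1 (Cexp (Cscal s z)))) (RtoC (ln s))).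
  assert (Du : forall s, 0 < s -> cderiv u s Czero).
  { intros s Hs. eapply cderiv_eq.
    - apply cderiv_add; [apply cderiv_add; [now apply cderiv_glog|now apply cderiv_Li]|].
      apply cderiv_RtoC, (is_derive_ln_tower 1 s Hs).
    - rewrite glog_Li by assumption. change (1 - 1)%Z with 0%Z. change (- Z.of_nat 0)%Z with 0%Z. cbn [Cpow]. ring. }
  assert (U : u t = u 1).
  { destruct (Rle_lt_dec 1 t); [symmetry|]; apply cderiv_zero_const; try lra; intros; apply Du; lra. }
  unfold u in U. rewrite Cscal_1, ln_1 in U. fold (kappa z) in U.
  change (RtoC 0) with Czero in U.
  replace (kappa z) with (Cadd (kappa z) Czero) by ring.
  rewrite <- U. ring.
Qed.

(** For every [t > 0] the left side equals [(1 - exp (t z)) exp (Li 1 (exp (t z)))]. It does not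
    depend on [t], and the right side tends to 1 as [t] grows. *)
Lemma Cexp_kappa z : Cre z < 0 -> Cmul (Cexp (kappa z)) (Copp z) = Cone.
Proof.
  intros Hz.
  assert (E : forall t, 0 < t -> Cmul (Cexp (kappa z)) (Copp z) =
     Cmul (Cadd Cone (Cmul (RtoC (-1)) (Cexp (Cscal t z)))) (Cexp (Li 1 (Cexp (Cscal t z))))).
  { intros t Ht.
    replace (kappa z) with (Cadd (Cadd (glog z 1 t) (Li 1 (Cexp (Cscal t z)))) (RtoC (ln t)))
      by (rewrite glog_1_eq by assumption; ring).
    rewrite !Cexp_add, Cexp_RtoC, exp_ln, Cexp_glog by assumption.
    transitivity (Copp (Cmul (Cmul (Cscal t z) (Fser 1 z t)) (Cexp (Li 1 (Cexp (Cscal t z)))))).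
    - rewrite Cscal_RtoC. ring.
    - rewrite Fser1_eq. replace (RtoC (-1)) with (Copp Cone) by cc. ring. }
  apply (Clim_seq_unique (fun _ => Cmul (Cexp (kappa z)) (Copp z))); [apply Clim_seq_const|].
  assert (H1 : forall k, 0 < INR (S k)) by (intros; apply lt_0_INR; lia).
  eapply Clim_seq_ext; [intros k; symmetry; apply (E (INR (S k)) (H1 k))|].
  eapply Clim_seq_eq.
  - apply Clim_seq_mul; [|apply Clim_seq_exp, Li1_lim, Hz].
    apply Clim_seq_add; [apply Clim_seq_const|]. apply Clim_seq_mul; [apply Clim_seq_const|].
    apply Clim_seq_norm0 with (fun k => exp (INR (S k) * Cre z)); [|now apply is_lim_exp_neg].
    intros k. rewrite Cnorm_Cexp. apply Rle_refl.
  - rewrite Cexp_0. ring.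
Qed.

Lemma Clim_seq_cderiv f l t (tk : nat -> R) : cderiv f t l -> is_lim_seq tk t -> Clim_seq (fun k => f (tk k)) (f t).
Proof.
  intros [H1 H2] Ht. split.
  - apply (is_lim_seq_continuous (fun s => fst (f s))); [|assumption].
    apply derivable_continuous_pt. exists (fst l). now apply is_derive_Reals.
  - apply (is_lim_seq_continuous (fun s => snd (f s))); [|assumption].
    apply derivable_continuous_pt. exists (snd l). now apply is_derive_Reals.
Qed.

Lemma ln_tower_0_lim : is_lim_seq (fun k => ln_tower 0 (/ INR (S k))) 0.
Proof.
  assert (H1 : forall k, 0 < INR (S k)) by (intros; apply lt_0_INR; lia).
  apply (is_lim_seq_ext (fun k => - (ln (INR (S k)) / INR (S k)) - / INR (S k))).
  { intros k. unfold ln_tower. rewrite ln_Rinv by apply H1. field. generalize (H1 k); lra. }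
  replace (Finite 0) with (Finite (- 0 - 0)) by (f_equal; ring).
  apply is_lim_seq_minus'; [|apply is_lim_inv_S].
  apply (is_lim_seq_opp _ 0).
  apply (is_lim_comp_seq (fun y => ln y / y) (fun k => INR (S k)) p_infty 0).
  - apply is_lim_div_ln_p.
  - exists 0%nat. intros; discriminate.
  - apply (is_lim_seq_incr_1 INR), is_lim_seq_INR.
Qed.

(** The integral of [g] is read off from a primitive that contains [Li 2 (exp (s z)) / z] and
    [s ln s - s]. Both are singular at 0, so the constant is found as a limit there; the summand
    [Cone] is minus the value of [s ln s - s] at 1. *)
Lemma glog_0_at_1 z : Cre z < 0 -> glog z 0 1 = Cadd (Csub (kappa z) (pfun z)) Cone.
Proof.
  intros Hz. assert (Hz0 := Cre_neg_neq z Hz).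
  set (u := fun s => Cadd (Cadd (Cadd (glog z 0 s) (Cmul (Cinv z) (Li 2 (Cexp (Cscal s z))))) (RtoC (ln_tower 0 s)))
      (Cmul (Copp (kappa z)) (Cscal s Cone))).
  assert (Du : forall s, 0 < s -> cderiv u s Czero).
  { intros s Hs. eapply cderiv_eq.
    - apply cderiv_add; [|apply cderiv_cmul, cderiv_line].
      apply cderiv_add; [apply cderiv_add; [now apply cderiv_glog|now apply cderiv_cmul, cderiv_Li]|].
      apply cderiv_RtoC, (is_derive_ln_tower 0 s Hs).
    - rewrite glog_1_eq by assumption. change (2 - 1)%Z with 1%Z. change (ln_tower 1 s) with (ln s). field. assumption. }
  assert (H1 : forall k, 0 < / INR (S k)) by (intros; apply Rinv_0_lt_compat, lt_0_INR; lia).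
  assert (U : forall t, 0 < t -> u 1 = u t).
  { intros t Ht. destruct (Rle_lt_dec 1 t); [|symmetry]; apply cderiv_zero_const; try lra; intros; apply Du; lra. }
  assert (E : u 1 = Cmul (Cinv z) (RtoC Li2_one)).
  { apply (Clim_seq_unique (fun _ => u 1)); [apply Clim_seq_const|].
    eapply Clim_seq_ext; [intros k; symmetry; apply (U _ (H1 k))|].
    eapply Clim_seq_eq.
    - apply Clim_seq_add; [apply Clim_seq_add; [apply Clim_seq_add|]|].
      + eapply Clim_seq_cderiv; [now apply cderiv_glog|apply is_lim_inv_S].
      + apply Clim_seq_mul; [apply Clim_seq_const|now apply Li2_lim].
      + apply Clim_seq_RtoC, ln_tower_0_lim.
      + apply Clim_seq_mul; [apply Clim_seq_const|]. apply Clim_seq_line, is_lim_inv_S.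
    - rewrite glog_0_at_0. change (RtoC 0) with Czero. replace (Cscal 0 Cone) with Czero by cc. ring. }
  unfold u in E. rewrite !Cscal_1 in E.
  replace (ln_tower 0 1) with (- (1)) in E by (unfold ln_tower; rewrite ln_1; ring). rewrite RtoC_opp, RtoC_1 in E.
  unfold pfun. revert E. generalize (glog z 0 1) (Li 2 (Cexp z)) (kappa z). intros g l k E.
  transitivity (Cadd (Cadd (Csub (Cmul (Cinv z) (RtoC Li2_one)) (Cmul (Cinv z) l)) Cone) k).
  - rewrite <- E. ring.
  - field. assumption.
Qed.

(** Otherwise [Fser 1 z t] would be a negative real number and [exp (t z) - 1], being [t z] times
    it, would have positive real part, although [|exp (t z)| < 1]. *)
Lemma glog_1_not_opposite z t y : Cre z < 0 -> 0 < t -> cos y = -1 -> snd (glog z 1 t) <> y.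
Proof.
  intros Hz Ht Hy E.
  assert (E1 := f_equal fst (Fser1_eq z t)). rewrite <- Cexp_glog in E1 by assumption.
  assert (Hs : sin y = 0) by (generalize (sin2_cos2 y); unfold Rsqr; rewrite Hy; nra).
  cbn [fst snd Cmul Cexp Cscal Csub Cadd Copp Cone] in E1. rewrite E, Hy, Hs in E1. unfold Cre in Hz.
  assert (P := exp_pos (fst (glog z 1 t))).
  assert (Q : exp (t * fst z) < 1) by (apply exp_neg_lt1; nra).
  generalize (exp_pos (t * fst z)) (COS_bound (t * snd z)). intros P' Hc.
  assert (t * fst z < 0) by nra.
  nra.
Qed.

(** The branch of the square root: [exp (- glog z 1 t) = -tz/(1-exp(tz))] never meets the
    negative axis, both numerator and denominator having positive real part. *)
Lemma glog_1_im_lt_PI z : Cre z < 0 -> - PI < snd (glog z 1 1) < PI.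
Proof.
  intros Hz. assert (HPI := PI_RGT_0).
  assert (Hc : continuity (fun t => snd (glog z 1 t))).
  { intros t. apply derivable_continuous_pt. exists (snd (glog z 2 t)).
    apply is_derive_Reals. apply (cderiv_glog z 1 t Hz). }
  assert (H0 : snd (glog z 1 0) = 0) by now rewrite glog_1_at_0.
  assert (IV : forall y, cos y = -1 -> y <> 0 ->
     ~ (Rmin (snd (glog z 1 0)) (snd (glog z 1 1)) <= y <= Rmax (snd (glog z 1 0)) (snd (glog z 1 1)))).
  { intros y Hy Hy0 Hb. destruct (IVT_gen (fun t => snd (glog z 1 t)) 0 1 y Hc Hb) as [t [Ht E]].
    rewrite Rmin_left, Rmax_right in Ht by lra.
    destruct (Req_dec t 0) as [->|]; [lra|].
    revert E. apply glog_1_not_opposite; [assumption|lra|assumption]. }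
  rewrite H0 in IV. generalize (IV PI cos_PI ltac:(lra)) (IV (- PI) ltac:(rewrite cos_neg; apply cos_PI) ltac:(lra)).
  unfold Rmin, Rmax. destruct (Rle_dec 0 (snd (glog z 1 1))); intros; split;
   apply Rnot_le_lt; intros ?; lra.
Qed.

(** Half-angle formulas. The bound on the argument makes [cos c] positive at the half angle [c], so
    [sin (2 c)] and [sin c] have the same sign, and the sign test of [Csqrt] selects the right
    root. *)
Lemma Csqrt_Cexp w : - PI < snd w < PI -> Csqrt (Cexp w) = Cexp (Cscal (/ 2) w).
Proof.
  destruct w as [a b]; cbn [fst snd]; intros Hb.
  unfold Csqrt. rewrite Cnorm_Cexp. cbv zeta. unfold Cexp, Cscal. cbn [fst snd].
  set (c := / 2 * b). replace b with (2 * c) by (unfold c; field).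
  assert (Ea : exp a = exp (/ 2 * a) * exp (/ 2 * a)) by (rewrite <- exp_plus; f_equal; field).
  assert (P := exp_pos (/ 2 * a)). assert (P' := exp_pos a).
  assert (Hc : 0 < cos c) by (apply cos_gt_0; unfold c; lra).
  apply CC_eq; cbn [fst snd].
  - rewrite cos_2a_cos.
    replace ((exp a + exp a * (2 * cos c * cos c - 1)) / 2) with (Rsqr (exp (/ 2 * a) * cos c))
      by (unfold Rsqr; rewrite Ea; field).
    rewrite sqrt_Rsqr; [reflexivity|]. nra.
  - rewrite cos_2a_sin.
    replace ((exp a - exp a * (1 - 2 * sin c * sin c)) / 2) with (Rsqr (exp (/ 2 * a) * sin c))
      by (unfold Rsqr; rewrite Ea; field).
    rewrite sqrt_Rsqr_abs, Rabs_mult, (Rabs_pos_eq (exp _)) by lra. rewrite sin_2a.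
    destruct (Rlt_dec (exp a * (2 * sin c * cos c)) 0) as [H|H].
    + assert (sin c < 0).
      { apply Rnot_le_lt. intros Hs. apply Rlt_not_le in H. apply H.
        apply Rmult_le_pos; [lra|]. apply Rmult_le_pos; lra. }
      rewrite Rabs_left by assumption. ring.
    + assert (0 <= sin c).
      { apply Rnot_lt_le. intros Hs. apply H. assert (0 < exp a * (cos c * - sin c)) by (repeat apply Rmult_lt_0_compat; lra). lra. }
      rewrite Rabs_pos_eq by assumption. ring.
Qed.

(** * The q-Pochhammer symbol *)

(** Each of [N] steps errs by [O(h^(L+2))]; dividing by [h = 1/N] leaves [O(N^-L)]. At this order
    the symbol also produces the term of index [L], which is of the size of the error and is
    absorbed through [M2]. *)
Lemma euler_maclaurin_unit L (H : nat -> R -> R) (M1 M2 : R) N :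
  (1 <= L)%nat -> (1 <= N)%nat ->
  (forall k t, 0 <= t <= 1 -> is_derive (H k) t (H (S k) t)) ->
  (forall t, 0 <= t <= 1 -> Rabs (H (S (S L)) t) <= M1) ->
  (forall t, 0 <= t <= 1 -> Rabs (H (S L) t) <= M2) ->
  Rabs (rsum N (fun k => H 1%nat (INR (S k) * / INR N))
    - (INR N * (H 0%nat 1 - H 0%nat 0) + / 2 * (H 1%nat 1 - H 1%nat 0)
       + rsum L (fun l => if Nat.eqb l 0 then 0 else / INR N ^ l * (beta (S l) * (H (S l) 1 - H (S l) 0)))))
  <= (rsum (S (S L)) (fun j => Rabs (beta j)) * M1 + 2 * Rabs (beta (S L)) * M2) / INR N ^ L.
Proof.
  intros HL HN Hd HM1 HM2.
  assert (Np := lt_0_INR N HN).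
  set (h := / INR N). assert (Hh : 0 < h) by now apply Rinv_0_lt_compat.
  assert (E1 : INR N * h = 1) by (unfold h; field; lra).
  assert (EM := euler_maclaurin_sum L H h M1 N ltac:(lra)). rewrite E1 in EM. specialize (EM Hd HM1).
  set (T := fun l => if Nat.eqb l 0 then 0 else / INR N ^ l * (beta (S l) * (H (S l) 1 - H (S l) 0))).
  assert (EQ : INR N * (emq (S L) h H 1 - emq (S L) h H 0)
     = INR N * (H 0%nat 1 - H 0%nat 0) - / 2 * (H 1%nat 1 - H 1%nat 0) + (rsum L T + T L)).
  { unfold emq. rewrite <- rsum_minus, <- rsum_scal, <- rsum_S.
    rewrite rsum_shift, rsum_shift, (rsum_shift L T).
    rewrite beta_0, beta_1.
    rewrite (rsum_ext L (fun k => INR N * (beta (S (S k)) * _ * _ - _)) (fun l => T (S l))).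
    - unfold T. cbn [Nat.eqb pow]. 
      match goal with |- ?a + (INR N * (?b * _ * ?c - _ * ?d) + ?e) = _ =>
        transitivity (a + (INR N * h * (b * (c - d)) + e)); [ring|] end.
      rewrite E1. ring.
    - intros l _. unfold T. cbn [Nat.eqb].
      replace (h ^ S (S l)) with (h * h ^ S l) by reflexivity.
      rewrite <- pow_inv. fold h.
      replace (INR N * (beta (S (S l)) * (h * h ^ S l) * H (S (S l)) 1 - beta (S (S l)) * (h * h ^ S l) * H (S (S l)) 0))
        with (INR N * h * (h ^ S l * (beta (S (S l)) * (H (S (S l)) 1 - H (S (S l)) 0)))) by ring.
      rewrite E1. ring. }
  (* Passing from left to right end points turns the coefficient [- 1/2] of the boundary term, which
     comes from [beta 1], into [+ 1/2]. *)
  assert (TE : rsum N (fun k => H 1%nat (INR (S k) * h)) =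
     rsum N (fun k => H 1%nat (INR k * h)) + (H 1%nat 1 - H 1%nat 0)).
  { generalize (rsum_telescope N (fun k => H 1%nat (INR k * h))). cbn beta.
    rewrite E1, rsum_minus. change (INR 0) with 0. rewrite Rmult_0_l. lra. }
  rewrite TE.
  set (S0 := rsum N (fun k => H 1%nat (INR k * h))) in *.
  match goal with |- Rabs ?x <= _ => replace x with
    (- (INR N * (emq (S L) h H 1 - emq (S L) h H 0 - h * S0)) + T L) end.
  2:{ rewrite (Rmult_minus_distr_l (INR N) _ (h * S0)), EQ.
      replace (INR N * (h * S0)) with (INR N * h * S0) by ring. rewrite E1. field. }
  eapply Rle_trans; [apply Rabs_triang|]. rewrite Rabs_Ropp, Rabs_mult, (Rabs_pos_eq (INR N)) by lra.
  unfold Rdiv. rewrite Rmult_plus_distr_r. apply Rplus_le_compat.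
  - apply Rle_trans with (INR N * (INR N * (rsum (S (S L)) (fun j => Rabs (beta j)) * M1 * h ^ S (S L)))).
    + apply Rmult_le_compat_l; [lra|exact EM].
    + right. rewrite <- pow_inv. fold h. cbn [pow].
      match goal with |- INR N * (INR N * (?a * (h * (h * ?b)))) = _ =>
        transitivity ((INR N * h) * (INR N * h) * (a * b)); [ring|] end.
      rewrite E1. ring.
  - unfold T. destruct (Nat.eqb_spec L 0); [lia|].
    assert (P : 0 < / INR N ^ L) by now apply Rinv_0_lt_compat, pow_lt.
    rewrite !Rabs_mult, (Rabs_pos_eq (/ _)) by lra.
    rewrite (Rmult_comm _ (/ INR N ^ L)). apply Rmult_le_compat_l; [lra|].
    replace (2 * Rabs (beta (S L)) * M2) with (Rabs (beta (S L)) * (M2 + M2)) by ring.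
    apply Rmult_le_compat_l; [apply Rabs_pos|].
    unfold Rminus. eapply Rle_trans; [apply Rabs_triang|]. rewrite Rabs_Ropp.
    apply Rplus_le_compat; apply HM2; lra.
Qed.

Definition glog_correction (z : CC) (l : nat) : CC :=
  if Nat.eqb l 0 then Czero else Cscal (beta (S l)) (Csub (glog z (S l) 1) (glog z (S l) 0)).

Definition glog_main (L N : nat) (z : CC) : CC :=
  Cadd (Cadd (Cscal (INR N) (glog z 0 1)) (Cscal (/ 2) (glog z 1 1)))
       (Csum L (fun l => if Nat.eqb l 0 then Czero else Cscal (/ INR N ^ l) (glog_correction z l))).

(** Euler-Maclaurin is applied to the real and the imaginary part separately, hence the constant
    [K + K]. *)
Lemma glog_sum L delta C : (1 <= L)%nat -> 0 < delta ->
  exists K, forall N z, (1 <= N)%nat -> Cre z <= - delta -> Cnorm z <= C ->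
  Cnorm (Csub (Csum N (fun k => glog z 1 (INR (S k) * / INR N))) (glog_main L N z)) <= K / INR N ^ L.
Proof.
  intros HL Hd. destruct L as [|L]; [lia|].
  (* For [S L] in place of the order, the bounds concern [glog] at indices [L + 3] and [L + 2]. Both
     are at least 2, so they are values of [deval] and bounded uniformly in [z]. *)
  destruct (deval_bound (Nat.iter (S L) dD glog_expr) delta C Hd) as [M1 HM1].
  destruct (deval_bound (Nat.iter L dD glog_expr) delta C Hd) as [M2 HM2].
  set (K := rsum (S (S (S L))) (fun j => Rabs (beta j)) * M1 + 2 * Rabs (beta (S (S L))) * M2).
  exists (K + K). intros N z HN Hz HC.
  assert (Hz' : Cre z < 0) by lra.
  assert (P : forall p : CC -> R, (forall w, Rabs (p w) <= Cnorm w) ->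
    (forall k t, is_derive (fun s => p (glog z k s)) t (p (glog z (S k) t))) ->
    Rabs (rsum N (fun k => p (glog z 1 (INR (S k) * / INR N)))
    - (INR N * (p (glog z 0 1) - p (glog z 0 0)) + / 2 * (p (glog z 1 1) - p (glog z 1 0))
       + rsum (S L) (fun l => if Nat.eqb l 0 then 0 else / INR N ^ l * (beta (S l) * (p (glog z (S l) 1) - p (glog z (S l) 0))))))
    <= K / INR N ^ S L).
  { intros p Hp Dp.
    apply (euler_maclaurin_unit (S L) (fun k t => p (glog z k t)) M1 M2 N HL HN).
    - intros k t _. apply Dp.
    - intros t Ht. eapply Rle_trans; [apply Hp|]. now apply HM1.
    - intros t Ht. eapply Rle_trans; [apply Hp|]. now apply HM2. }
  assert (P1 := P fst Cnorm_fst (fun k t => proj1 (cderiv_glog z k t Hz'))).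
  assert (P2 := P snd Cnorm_snd (fun k t => proj2 (cderiv_glog z k t Hz'))).
  rewrite glog_0_at_0, glog_1_at_0 in P1, P2. cbn [fst snd Czero] in P1, P2. rewrite !Rminus_0_r in P1, P2.
  eapply Rle_trans; [apply Cnorm_le_sum|].
  unfold Rdiv. rewrite Rmult_plus_distr_r.
  unfold glog_main. apply Rplus_le_compat.
  - cbn [fst Csub Cadd Copp Cscal]. rewrite !fst_Csum.
    eapply Rle_trans; [right; f_equal|exact P1].
    unfold Rminus. do 4 f_equal. apply rsum_ext. intros l _. unfold glog_correction.
    destruct (Nat.eqb l 0); reflexivity.
  - cbn [snd Csub Cadd Copp Cscal]. rewrite !snd_Csum.
    eapply Rle_trans; [right; f_equal|exact P2].
    unfold Rminus. do 4 f_equal. apply rsum_ext. intros l _. unfold glog_correction.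
    destruct (Nat.eqb l 0); reflexivity.
Qed.

Lemma glog_correction_eq z l : Cre z < 0 -> (1 <= l)%nat ->
  glog_correction z l = Csub (Copp (ffun l z)) (RtoC (stirling_term l)).
Proof.
  intros Hz Hl. destruct l as [|n]; [lia|].
  unfold glog_correction, stirling_term, ffun. fold (beta (S (S n))). cbn [Nat.eqb].
  rewrite (glog_Li z n 1 Hz) by lra. rewrite Cscal_1.
  replace (1 - Z.of_nat (S n))%Z with (- Z.of_nat n)%Z by lia.
  generalize (Cmul (Cpow z (S n)) (Li (- Z.of_nat n) (Cexp z))). intros w.
  destruct n as [|n].
  - rewrite glog_2_at_0. simpl (Nat.eqb 0 0). rewrite beta_2. apply CC_eq; simpl; field.
  - simpl (Nat.eqb (S n) 0).
    (* The index is [n + 3]: for even [n] it is odd and [beta] vanishes, for odd [n] the derivative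
       at 0 does. *)
    assert (Z0 : Cscal (beta (S (S (S n)))) (glog z (S (S (S n))) 0) = Czero).
    { destruct (Nat.Even_or_Odd n) as [[m E]|[m E]].
      - rewrite beta_odd; [cc| |lia]. apply Nat.odd_spec. exists (S m). lia.
      - replace (S (S (S n))) with (2 * m + 4)%nat by lia. rewrite glog_even_at_0 by assumption. cc. }
    rewrite !Cscal_RtoC in *. rewrite RtoC_mult.
    transitivity (Csub (Cmul (RtoC (beta (S (S (S n))))) (Csub (Copp w) (RtoC (ln_tower (S (S (S n))) 1))))
       (Cmul (RtoC (beta (S (S (S n))))) (glog z (S (S (S n))) 0))); [ring|].
    rewrite Z0. ring.
Qed.

(** Each factor [1 - exp (t z) = - t z Fser 1 z t] is [exp (g t + ln t - kappa)], because
    [exp (- kappa) = - z]. The number of factors [n] is kept apart from the [N] in [t = k/N] for the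
    induction. *)
Lemma qpoch_eq z N n : Cre z < 0 -> (1 <= N)%nat ->
  qpoch (Cexp (Cscal (/ INR N) z)) n =
  Cexp (Cadd (Csum n (fun k => glog z 1 (INR (S k) * / INR N)))
    (Csub (RtoC (ln (INR (fact n)) - INR n * ln (INR N))) (Cscal (INR n) (kappa z)))).
Proof.
  intros Hz HN. assert (Np := lt_0_INR N HN).
  induction n as [|n IH].
  - unfold qpoch. cbn [Cprod Csum fact]. change (INR 1) with 1. change (INR 0) with 0. rewrite ln_1.
    rewrite <- Cexp_0. f_equal. cc.
  - unfold qpoch in *. cbn [Cprod Csum]. rewrite IH. clear IH.
    assert (Sp := lt_0_INR (S n) ltac:(lia)).
    set (t := INR (S n) * / INR N). assert (Ht : 0 < t) by (apply Rmult_lt_0_compat; [lra|now apply Rinv_0_lt_compat]).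
    rewrite Cpow_Cexp. replace (Cscal (INR (S n)) (Cscal (/ INR N) z)) with (Cscal t z) by (unfold t; cc).
    replace (Csub Cone (Cexp (Cscal t z))) with
      (Cexp (Cadd (glog z 1 t) (Csub (RtoC (ln (INR (S n)) - ln (INR N))) (kappa z)))).
    + rewrite <- Cexp_add. f_equal.
      assert (Fp := lt_0_INR _ (lt_O_fact n)).
      rewrite fact_simpl, mult_INR, ln_mult by lra. rewrite !S_INR, !Cscal_RtoC.
      generalize (Csum n (fun k => glog z 1 (INR (S k) * / INR N))). intros s.
      unfold Rminus. rewrite !RtoC_plus, !RtoC_opp, !RtoC_mult, !RtoC_plus, RtoC_1. ring.
    + assert (K := Cexp_kappa z Hz). assert (Hn := Cexp_neq (kappa z)).
      unfold Csub at 1. rewrite !Cexp_add, Cexp_opp, Cexp_glog, Cexp_RtoC by assumption.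
      replace (exp (ln (INR (S n)) - ln (INR N))) with t.
      * transitivity (Cmul (Cmul (Fser 1 z t) (Cmul (RtoC t) (Cinv (Cexp (kappa z))))) (Cmul (Cexp (kappa z)) (Copp z))).
        { rewrite K. ring. }
        transitivity (Copp (Cmul (Cscal t z) (Fser 1 z t))).
        { rewrite Cscal_RtoC. field. assumption. }
        rewrite Fser1_eq. ring.
      * unfold t. unfold Rminus. rewrite exp_plus, exp_Ropp, !exp_ln by assumption. reflexivity.
Qed.

(** [- z / (1 - exp z)] is the inverse of [Fser 1 z 1], that is [exp (- g 1)]. Adding the real
    number [ln (2 PI N)] to the exponent leaves its imaginary part unchanged, so the principal root
    halves the exponent. *)
Lemma Csqrt_prefactor z N : Cre z < 0 -> (1 <= N)%nat ->
  Csqrt (Cdiv (Copp z) (Cscal (2 * PI * INR N) (Csub Cone (Cexp z)))) =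
  Cexp (Copp (Cscal (/ 2) (Cadd (glog z 1 1) (RtoC (ln (2 * PI * INR N)))))).
Proof.
  intros Hz HN. assert (Np := lt_0_INR N HN). assert (HPI := PI_RGT_0).
  assert (P : 0 < 2 * PI * INR N) by (apply Rmult_lt_0_compat; lra).
  assert (Hq := Cexp_line_neq1 z 1 Hz ltac:(lra)). rewrite Cscal_1 in Hq.
  assert (HF := Fser1_neq z 1 Hz). assert (E := Fser1_eq z 1). rewrite Cscal_1 in E.
  replace (Cdiv (Copp z) (Cscal (2 * PI * INR N) (Csub Cone (Cexp z)))) with
    (Cexp (Copp (Cadd (glog z 1 1) (RtoC (ln (2 * PI * INR N)))))).
  - rewrite Csqrt_Cexp.
    + f_equal. cc.
    + generalize (glog_1_im_lt_PI z Hz). cbn [snd Copp Cadd RtoC]. lra.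
  - rewrite Cexp_opp, Cexp_add, Cexp_RtoC, exp_ln, Cexp_glog by assumption.
    rewrite Cscal_RtoC.
    replace (Csub Cone (Cexp z)) with (Copp (Cmul z (Fser 1 z 1))) by (rewrite E; ring).
    assert (HP := RtoC_neq _ (Rgt_not_eq _ _ P)). assert (Hz0 := Cre_neg_neq z Hz).
    generalize dependent (RtoC (2 * PI * INR N)). intros c Hc. field.
    repeat split; try assumption.
    replace (Copp (Cmul z (Fser 1 z 1))) with (Csub Cone (Cexp z)) by (rewrite E; ring). assumption.
Qed.

Theorem theorem2p1 (L : nat) (delta Cb : R) :
  (1 <= L)%nat -> 0 < delta -> 0 < Cb ->
  exists K : R, 0 < K /\
    forall (N : nat) (z : CC),
      (1 <= N)%nat -> Cre z <= - delta -> Cnorm z <= Cb ->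
      exists E : CC,
        Cnorm E <= K / (INR N ^ L) /\
        Cinv (qpoch (Cexp (Cscal (/ INR N) z)) N) =
        Cmul
          (Csqrt (Cdiv (Copp z)
                       (Cscal (2 * PI * INR N) (Csub Cone (Cexp z)))))
          (Cexp (Cadd (Cadd (Cscal (INR N) (pfun z))
                            (Csum L (fun l => if Nat.eqb l 0 then Czero
                                              else Cscal (/ (INR N ^ l)) (ffun l z))))
                      E)).
Proof.
  intros HL Hd HC.
  destruct (glog_sum L delta Cb HL Hd) as [K1 HK1].
  (* At [pred L] the series has the terms of index below [L] and an error of order [N^-L]. *)
  destruct (stirling_series (pred L)) as [K2 HK2].
  replace (S (pred L)) with L in HK2 by lia.
  (* The signs of [K1] and [K2] are unknown; the absolute values and the summand 1 make the constant
     positive. *)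
  exists (Rabs K1 + Rabs K2 + 1). split.
  { generalize (Rabs_pos K1) (Rabs_pos K2). lra. }
  intros N z HN Hz HzC. specialize (HK1 N z HN Hz HzC). specialize (HK2 N HN).
  assert (Hz' : Cre z < 0) by lra.
  assert (Np := lt_0_INR N HN).
  set (S0 := Csum N (fun k => glog z 1 (INR (S k) * / INR N))) in *.
  set (st := rsum L (fun l => stirling_term l / INR N ^ l)) in *.
  set (e1 := Csub S0 (glog_main L N z)) in *.
  set (e2 := ln (INR (fact N)) - _) in HK2.
  (* Both errors belong to the logarithm of the Pochhammer symbol itself; the reciprocal changes
     their sign. *)
  exists (Copp (Cadd e1 (RtoC e2))). split.
  - rewrite Cnorm_opp. eapply Rle_trans; [apply Cnorm_triang|]. rewrite Cnorm_RtoC.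
    assert (P : 0 < / INR N ^ L) by now apply Rinv_0_lt_compat, pow_lt.
    unfold Rdiv in *. generalize (Rle_abs K1) (Rle_abs K2). intros.
    apply Rle_trans with ((K1 + K2) * / INR N ^ L); [lra|].
    apply Rmult_le_compat_r; lra.
  - rewrite qpoch_eq by assumption. rewrite Csqrt_prefactor by assumption.
    rewrite <- Cexp_opp, <- Cexp_add. f_equal. fold S0.
    (* Term by term, the corrections at the ends of the interval and Stirling's coefficients add up
       to [- f_l / N^l]. *)
    assert (EC : Cadd (Csum L (fun l => if Nat.eqb l 0 then Czero else Cscal (/ INR N ^ l) (glog_correction z l))) (RtoC st)
       = Copp (Csum L (fun l => if Nat.eqb l 0 then Czero else Cscal (/ (INR N ^ l)) (ffun l z)))).
    { unfold st. clear -Hz' Np. induction L as [|L IH]; [cbn [Csum rsum]; cc|].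
      cbn [Csum rsum]. rewrite RtoC_plus.
      transitivity (Cadd (Cadd (Csum L (fun l => if Nat.eqb l 0 then Czero else Cscal (/ INR N ^ l) (glog_correction z l)))
         (RtoC (rsum L (fun l => stirling_term l / INR N ^ l))))
         (Cadd (if Nat.eqb L 0 then Czero else Cscal (/ INR N ^ L) (glog_correction z L)) (RtoC (stirling_term L / INR N ^ L)))); [ring|].
      rewrite IH. destruct (Nat.eqb_spec L 0) as [->|HL0].
      - unfold stirling_term; simpl. cc. field.
      - rewrite glog_correction_eq by (try assumption; lia). unfold Rdiv.
        rewrite RtoC_mult, !Cscal_RtoC. ring. }
    assert (ES : S0 = Cadd e1 (glog_main L N z)) by (unfold e1; ring).
    assert (EL : ln (INR (fact N)) = e2 + (INR N * ln (INR N) - INR N + / 2 * ln (2 * PI * INR N) + st))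
      by (unfold e2; ring).
    (* In the exponent [N kappa] and [N ln N] cancel, as does [- N] from Stirling against the [Cone]
       of [glog_0_at_1]. Half of [g 1 + ln (2 PI N)] is the square root, and the rest is [- N p],
       the sum and the errors. *)
    rewrite ES, EL. unfold glog_main. rewrite glog_0_at_1 by assumption.
    revert EC.
    generalize (Csum L (fun l => if Nat.eqb l 0 then Czero else Cscal (/ INR N ^ l) (glog_correction z l))).
    generalize (Csum L (fun l => if Nat.eqb l 0 then Czero else Cscal (/ (INR N ^ l)) (ffun l z))).
    intros F U EC. replace F with (Copp (Copp F)) by ring. rewrite <- EC.
    rewrite !Cscal_RtoC. unfold Rminus. rewrite !RtoC_plus, !RtoC_opp, !RtoC_mult. ring.
Qed.
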